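(* Let $p,q\in\mathbb{Z}$ be relatively prime and $\sigma:=\sqrt{p^2+q^2}$. For $a,b,c,d>0$ consider the time-frequency lattice $$\Delta_{a,b,c,d}:=\left(\begin{bmatrix} p/(a\sigma) & -q/(a\sigma)\\ q/(b\sigma) & p/(b\sigma)\end{bmatrix}\cdot\Big(\tfrac{c}{\sigma}\mathbb{Z}\times d\sigma\mathbb{Z}\Big)\right)\times a\mathbb{Z}\times b\mathbb{Z}\subset\mathbb{R}^4,$$ and the anisotropic Gaussian $g_{\alpha,\beta}(x,y):=e^{-(\alpha x^2+\beta y^2)}$ with shape parameters $\alpha>0$ and $\beta:=\alpha\frac{b^2}{a^2}$. If either (i) $c<1$ and $d<1$, or (ii) $c<\sigma^2$ and $d<\sigma^{-2}$, then the Gabor system $\mathcal{G}(g_{\alpha,\beta},\Delta_{a,b,c,d})$ is a frame of $L^2(\mathbb{R}^2)$.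
   Context: For $(t_1,t_2,\omega_1,\omega_2)\in\mathbb{R}^4$ and $g\in L^2(\mathbb{R}^2)$, $$\pi(t_1,t_2,\omega_1,\omega_2)g(x,y)=e^{2\pi i x\omega_1}e^{2\pi i y\omega_2}g(x-t_1,y-t_2).$$ The Gabor system with window $g$ and set of nodes $\Delta\subset\mathbb{R}^4$ (coordinates ordered as $(t_1,t_2,\omega_1,\omega_2)$) is $\mathcal{G}(g,\Delta)=\{\pi(z)g:z\in\Delta\}$; it is a frame of $L^2(\mathbb{R}^2)$ if there exist constants $A,B>0$ such that $A\|f\|_2^2\le\sum_{z\in\Delta}|\langle\pi(z)g,f\rangle|^2\le B\|f\|_2^2$ for all $f\in L^2(\mathbb{R}^2)$. For a matrix $M\in\mathbb{R}^{2\times2}$ and a set $S\subset\mathbb{R}^2$, $M\cdot S=\{Ms:s\in S\}$. *)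

(* Defs.v *)
From HB Require Import structures.
From mathcomp Require Import all_boot all_order all_algebra.
From mathcomp Require Import complex.
From mathcomp Require Import all_classical all_reals all_analysis.

Set Implicit Arguments.
Unset Strict Implicit.
Unset Printing Implicit Defensive.

Import Order.TTheory GRing.Theory Num.Theory.
Import numFieldNormedType.Exports.

Local Open Scope classical_set_scope.
Local Open Scope complex_scope.
Local Open Scope ring_scope.

Definition lebesgue2 (R : realType) :
    {measure set (measurableTypeR R * measurableTypeR R) -> \bar R} :=
  (@lebesgue_measure R \x @lebesgue_measure R)%E.

(* The library has neither a measurable structure on R[i] nor an integral of
   complex-valued functions, so both are taken componentwise. *)
Definition cmeasurable (R : realType) (f : R * R -> R[i]) : Prop :=
  measurable_fun [set: R * R] (fun x => complex.Re (f x)) /\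
  measurable_fun [set: R * R] (fun x => complex.Im (f x)).

Definition cintegral (R : realType) (f : R * R -> R[i]) : R[i] :=
  Rintegral (lebesgue2 R) setT (fun x => complex.Re (f x)) +i*
  Rintegral (lebesgue2 R) setT (fun x => complex.Im (f x)).

Definition L2norm (R : realType) (f : R * R -> R[i]) : \bar R :=
  Lnorm (lebesgue2 R) 2%:E (fun x => (Normc.normc (f x))%:E).

(* Elements of L^2(R^2) are represented by functions, not a.e. classes; L2norm
   and the inner product depend only on the class. *)
Definition inL2 (R : realType) (f : R * R -> R[i]) : Prop :=
  cmeasurable f /\ (L2norm f < +oo)%E.

(* Meaningful for f and g in L^2, where f * conj g is integrable. *)
Definition inner (R : realType) (f g : R * R -> R[i]) : R[i] :=
  cintegral (fun x => f x * conjc (g x)).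

(* e^{i theta} *)
Definition expi (R : realType) (theta : R) : R[i] := cos theta +i* sin theta.

(* A point (t1, t2, w1, w2) of R^4 is encoded as ((t1, t2), (w1, w2)). *)
Definition tfshift (R : realType) (z : (R * R) * (R * R))
    (g : R * R -> R[i]) : R * R -> R[i] :=
  fun x => expi (2 * pi * x.1 * z.2.1) * expi (2 * pi * x.2 * z.2.2)
           * g (x.1 - z.1.1, x.2 - z.1.2).

Definition gabor_energy (R : realType) (g : R * R -> R[i])
    (D : set ((R * R) * (R * R))) (f : R * R -> R[i]) : \bar R :=
  \esum_(z in D) ((Normc.normc (inner (tfshift z g) f)) ^+ 2)%:E.

Definition gabor_frame (R : realType) (g : R * R -> R[i])
    (D : set ((R * R) * (R * R))) : Prop :=
  exists A B : R, [/\ 0 < A, 0 < B &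
    forall f : R * R -> R[i], inL2 f ->
      (A%:E * L2norm f ^+ 2 <= gabor_energy g D f
       <= B%:E * L2norm f ^+ 2)%E].

Definition vec2 (R : realType) (v : R * R) : 'cV[R]_2 :=
  \col_i (if i == 0 then v.1 else v.2).

Definition mx2 (R : realType) (m00 m01 m10 m11 : R) : 'M[R]_2 :=
  \matrix_(i, j) (if i == 0 then (if j == 0 then m00 else m01)
                  else (if j == 0 then m10 else m11)).

Definition mximage (R : realType) (M : 'M[R]_2) (S : set (R * R)) :
    set (R * R) :=
  [set ((M *m vec2 s) 0 0, (M *m vec2 s) 1 0) | s in S].

Definition multZ (R : realType) (r : R) : set R :=
  range (fun k : int => r * k%:~R).

Definition tf_lattice (R : realType) (p q : int) (a b c d : R) :
    set ((R * R) * (R * R)) :=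
  let sigma := Num.sqrt (p%:~R ^+ 2 + q%:~R ^+ 2) in
  mximage (mx2 (p%:~R / (a * sigma)) (- q%:~R / (a * sigma))
               (q%:~R / (b * sigma)) (p%:~R / (b * sigma)))
          (multZ (c / sigma) `*` multZ (d * sigma))
  `*` (multZ a `*` multZ b).

Definition gaussian (R : realType) (alpha beta : R) : R * R -> R[i] :=
  fun x => (expR (- (alpha * x.1 ^+ 2 + beta * x.2 ^+ 2)))%:C.

(* Main.v *)
Require Import Defs.
From mathcomp Require Import all_boot all_order all_algebra.
From mathcomp Require Import complex qpoly.
From mathcomp Require Import ring lra zify.
From mathcomp Require Import all_classical all_reals all_analysis.
From mathcomp Require Import measurable_realfun.

Set Implicit Arguments.
Unset Strict Implicit.
Unset Printing Implicit Defensive.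

Import Order.TTheory GRing.Theory Num.Theory.
Import numFieldNormedType.Exports.

Local Open Scope classical_set_scope.
Local Open Scope ring_scope.

(** For a fixed point [t] of the time lattice the frequencies run over
    [a Z x b Z], so the inner products with the shifted Gaussians are the
    Fourier coefficients, up to conjugation and on the period cell
    [[0, 1/a) x [0, 1/b)], of the periodization of [f] times the Gaussian
    translated to [t].  Parseval's identity turns the sum over the frequencies into the integral over the
    cell of the squared periodization.  At a point [z] of the cell the
    periodization is [\sum_j c_j K_z(j, t)], where [c_j] is the value of [f] at
    [z + (j1 / a, j2 / b)] and [K_z(j, t)] the value at that point of the
    Gaussian centred at [t].  The frame inequalities therefore follow from an
    inequality between sequences: the samples
    [t |-> \sum_j c_j K_z(j, t)] determine [c] stably, uniformly in [z]
    ([stable_sampling]).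

    The relation [beta = alpha b^2 / a^2] makes the Gaussian round in the
    coordinates [(a x, b y)].  After the rotation by the direction of [(p, q)]
    the time lattice is rectangular with steps [c / sigma] and [d sigma], the
    Gaussian is still a product of two equal Gaussians, and the lattice of
    periods becomes [(p j1 + q j2, - q j1 + p j2) / sigma]
    ([shifted_window_rot]).  Since [p] and [q] are coprime, this lattice
    projects onto [Z / sigma] along either axis, with fibres that are cosets of
    [sigma Z].  The planar sampling problem thus splits into two sampling
    problems on the line ([stable_sampling_rotated]); projecting on the first
    axis the pairs (spacing of the centres, sampling step) are
    [(1 / sigma, c / sigma)] and [(sigma, d sigma)], which gives (i), and
    projecting on the second axis they are [(1 / sigma, d sigma)] and
    [(sigma, c / sigma)], which gives (ii).

    On the line, Gaussians centred at [s Z] and sampled with step [h < s] are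
    stably determined ([sampling_lower]).  Around its own centre each Gaussian
    turns the others into exponentials in the sample index [n], and Lagrange
    interpolation at geometric nodes isolates one of the coefficients.  The
    interpolation weights decay like [exp (- g h s n^2)]
    ([interpolation_weights]), faster than the factor [exp (g h^2 n^2)] lost
    on dividing by the Gaussian, so the left inverse has uniformly bounded row
    and column sums and Schur's test applies.

    Parseval's identity enters in the form of Bessel's inequality ([bessel2])
    and of a lower bound up to an arbitrary error ([parseval2_lower]), for
    bounded functions of bounded support.  Both come from one identity for the
    Fejer kernel ([fejer_defect]); the lower bound also uses Lusin's theorem.
    Truncation carries the frame inequalities over to real square integrable
    functions ([real_frame]), and averaging over the signs of the frequencies
    splits the coefficients of a complex function into those of its real and
    imaginary parts ([box_energy]). *)

(** * Sums over finite sets of integers *)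

Definition zrange (N : nat) : seq int :=
  [seq i%:Z - N%:Z | i <- index_iota 0 N.*2.+1].

#[global] Arguments zrange : simpl never.

Lemma mem_zrange N n : (n \in zrange N) = (`|n|%N <= N)%N.
Proof.
apply/mapP/idP => [ [j]|nN].
  rewrite mem_index_iota => /andP[_ jN] ->; lia.
exists (absz (n + N%:Z)); last lia.
rewrite mem_index_iota; lia.
Qed.

Lemma zrange_uniq N : uniq (zrange N).
Proof.
rewrite map_inj_uniq ?iota_uniq// => i j; lia.
Qed.

Lemma exists_zrange (s : seq int) : exists N, {subset s <= zrange N}.
Proof.
elim: s => [|a s [N sN]]; first by exists 0%N.
exists (maxn `|a|%N N) => x; rewrite inE mem_zrange => /orP[/eqP->|/sN].
  by rewrite leq_maxl.
by rewrite mem_zrange => /leq_trans; apply; rewrite leq_maxr.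
Qed.

Lemma zrange_sub N M : (N <= M)%N -> {subset zrange N <= zrange M}.
Proof. by move=> NM n; rewrite !mem_zrange => /leq_trans; apply. Qed.

Lemma ler_sum_sub (R : realType) (T : eqType) (s t : seq T) (F : T -> R) :
  uniq s -> uniq t -> {subset s <= t} -> (forall x, 0 <= F x) ->
  \sum_(x <- s) F x <= \sum_(x <- t) F x.
Proof.
move=> us ut st F0.
rewrite [leRHS](bigID (mem s))/= (perm_big [seq x <- t | x \in s]); last first.
  apply: uniq_perm => //; first exact: filter_uniq.
  by move=> x; rewrite mem_filter; case: (boolP (x \in s)) => // /st ->.
by rewrite big_filter lerDl sumr_ge0.
Qed.

Lemma exists_zrange2 (r : seq (int * int)) :
  exists N, forall j, j \in r -> (j.1 \in zrange N) && (j.2 \in zrange N).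
Proof.
have [N1 h1] := exists_zrange (map fst r); have [N2 h2] := exists_zrange (map snd r).
exists (maxn N1 N2) => j jr.
have := h1 j.1 (map_f _ jr); have := h2 j.2 (map_f _ jr).
rewrite !mem_zrange => j2 j1.
by rewrite !leq_max j1 j2 orbT.
Qed.

Lemma allpairs_pair_uniq (T1 T2 : eqType) (r1 : seq T1) (r2 : seq T2) :
  uniq r1 -> uniq r2 -> uniq [seq (x, y) | x <- r1, y <- r2].
Proof. by move=> u1 u2; apply: allpairs_uniq => // -[a b] [a' b']. Qed.

Lemma sum_zrange_opp (R : realType) (M : nat) (h : int -> R) :
  \sum_(k <- zrange M) h (- k) = \sum_(k <- zrange M) h k.
Proof.
rewrite -(big_map (fun k : int => - k) predT h); apply: perm_big; apply: uniq_perm.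
- by rewrite map_inj_uniq ?zrange_uniq//; exact: oppr_inj.
- exact: zrange_uniq.
- move=> k; rewrite mem_zrange; apply/mapP/idP => [[m]|kM].
    by rewrite mem_zrange => mM ->; rewrite abszN.
  by exists (- k); rewrite ?mem_zrange ?abszN ?opprK.
Qed.

Lemma sum_zrange_signs (R : realType) (M : nat) (h : int -> int -> R) :
  \sum_(l <- zrange M) \sum_(k <- zrange M) h k l =
  \sum_(l <- zrange M) \sum_(k <- zrange M)
    (h k l + h (- k) l + (h k (- l) + h (- k) (- l))) / 4.
Proof.
have sk l : \sum_(k <- zrange M) h (- k) l = \sum_(k <- zrange M) h k l.
  exact: (sum_zrange_opp M (h ^~ l)).
have sl : \sum_(l <- zrange M) \sum_(k <- zrange M) h k (- l) =
    \sum_(l <- zrange M) \sum_(k <- zrange M) h k l.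
  exact: (sum_zrange_opp M (fun l => \sum_(k <- zrange M) h k l)).
have E l : \sum_(k <- zrange M) (h k l + h (- k) l + (h k (- l) + h (- k) (- l))) / 4 =
    (\sum_(k <- zrange M) h k l + \sum_(k <- zrange M) h k (- l)) / 2.
  by rewrite -mulr_suml !big_split/= !sk; field.
under [RHS]eq_bigr => l _ do rewrite E.
by rewrite -mulr_suml big_split/= sl; field.
Qed.

Lemma sum_expr_le (R : realType) (q : R) (s : seq nat) :
  0 <= q < 1 -> uniq s -> \sum_(m <- s) q ^+ m <= (1 - q)^-1.
Proof.
move=> /andP[q0 q1] us.
have [M sM] : exists M, {subset s <= iota 0 M}.
  elim: s {us} => [|a s [M sM]]; first by exists 0%N.
  exists (maxn a.+1 M) => x; rewrite inE mem_iota => /orP[/eqP->|/sM]; first lia.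
  rewrite mem_iota; lia.
apply: le_trans (ler_sum_sub us (iota_uniq _ _) sM _) _.
  by move=> m; rewrite exprn_ge0.
have -> : \sum_(x <- iota 0 M) q ^+ x = \sum_(i < M) q ^+ i.
  by rewrite -(big_mkord predT (fun i => q ^+ i)) /index_iota subn0.
rewrite -[leRHS]mul1r ler_pdivlMr ?subr_gt0// mulrC.
have -> : (1 - q) * \sum_(i < M) q ^+ i = 1 - q ^+ M.
  by rewrite -opprB mulNr -subrX1 opprB.
by rewrite lerBlDr lerDl exprn_ge0.
Qed.

Lemma sum_expR_abs_le (R : realType) (l : R) : 0 < l ->
  exists2 K, 0 < K & forall s : seq int, uniq s ->
    \sum_(n <- s) expR (- l * `|n%:~R|) <= K.
Proof.
move=> l0; set q := expR (- l).
have q0 : 0 < q by exact: expR_gt0.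
have q1 : q < 1 by rewrite /q expR_lt1 oppr_lt0.
exists (2 * (1 - q)^-1) => [|s us]; first by rewrite mulr_gt0// invr_gt0 subr_gt0.
have E n : expR (- l * `|n%:~R|) = q ^+ `|n|%N.
  by rewrite -intr_norm -[in LHS]abszE mulrC expRM_natl.
under eq_bigr do rewrite E.
rewrite (bigID (fun n : int => 0 <= n)) /= mulrDl !mul1r.
by apply: lerD; rewrite -big_filter -(big_map absz predT (fun m => q ^+ m));
  apply: sum_expr_le; rewrite ?(ltW q0)// map_inj_in_uniq ?filter_uniq// => x y;
  rewrite !mem_filter; lia.
Qed.

(** * A discrete dual of the Gaussian *)

(** The coefficients of [\prod (X - x)] are dominated by those of
    [\prod (X + x)], and a polynomial with nonnegative coefficients is at
    least each of its monomials at [t]. *)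
Lemma coef_prod_XsubC_le (R : realType) (s : seq R) (t : R) k :
  0 <= t -> (forall x, x \in s -> 0 <= x) ->
  `|(\prod_(x <- s) ('X - x%:P))`_k| * t ^+ k <= \prod_(x <- s) (t + x).
Proof.
move=> t0; elim: s k => [|a s IH] k s0.
  rewrite !big_nil coef1; case: k => [|k] /=.
    by rewrite normr1 mul1r expr0.
  by rewrite normr0 mul0r.
rewrite !big_cons mulrBl coefB coefXM coefCM.
have a0 : 0 <= a by rewrite s0// mem_head.
have {}IH j := IH j (fun x xs => s0 x (mem_behead (s := a :: s) xs)).
rewrite mulrDl.
apply: le_trans (_ : _ <= (`|if k == 0%N then 0 else (\prod_(j <- s) ('X - j%:P))`_k.-1|
   + `|a * (\prod_(j <- s) ('X - j%:P))`_k|) * t ^+ k) _.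
  by rewrite ler_wpM2r ?exprn_ge0// ler_normB.
rewrite mulrDl; apply: lerD.
  case: k => [|k]; last first.
    by rewrite /= exprS mulrCA ler_wpM2l.
  rewrite /= normr0 mul0r mulr_ge0//.
  by rewrite big_seq prodr_ge0// => x xs; rewrite addr_ge0// s0// inE xs orbT.
by rewrite normrM (ger0_norm a0) -mulrA ler_wpM2l.
Qed.

(** The exponent left when every factor of a Lagrange polynomial is replaced by
    the larger of its two geometric nodes; doubled to avoid halves. *)
Lemma sum_minn (i k : nat) :
  ((\sum_(j < i + k) minn i j) * 2 + i * i.+1 = 2 * i * (i + k))%N.
Proof.
elim: k => [|k IH]; last first.
  rewrite addnS big_ord_recr/= (minn_idPl (leq_addr _ _)).
  rewrite mulnDl addnAC IH; nia.
rewrite addn0 (eq_bigr (fun j : 'I_i => j : nat)); last first.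
  by move=> j _; apply/minn_idPr/ltnW.
elim: i => [|i IH]; rewrite ?big_ord0// big_ord_recr/= mulnDl.
have -> : (i.+1 * i.+2 = i * i.+1 + 2 * i.+1)%N by nia.
rewrite addnACA IH; nia.
Qed.

(** The sum and the difference of two nodes of a geometric progression equal the
    larger node up to a factor whose logarithm decays geometrically in the
    distance of the indices.  Products over any number of nodes therefore lose
    only a bounded factor. *)
Lemma geom_add_le (R : realType) (l : R) (a b : nat) : 0 < l ->
  expR (- l * a%:R) + expR (- l * b%:R) <=
  expR (- l * (minn a b)%:R) * expR (expR (- l * `|a%:R - b%:R|)).
Proof.
move=> l0; wlog ab : a b / (a <= b)%N => [H|].
  have /orP[/H//|ba] := leq_total a b.
  by rewrite addrC minnC distrC H.
rewrite (minn_idPl ab) distrC ger0_norm ?subr_ge0 ?ler_nat//.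
have -> : expR (- l * b%:R) = expR (- l * a%:R) * expR (- l * (b%:R - a%:R)).
  by rewrite -expRD; congr expR; ring.
rewrite -[X in X + _]mulr1 -mulrDr ler_wpM2l ?expR_ge0//.
exact: expR_ge1Dx.
Qed.

Lemma geom_sub_ge (R : realType) (l : R) (a b : nat) : 0 < l -> a != b ->
  expR (- l * (minn a b)%:R) *
    expR (- ((1 - expR (- l))^-1 * expR (- l * `|a%:R - b%:R|))) <=
  `|expR (- l * a%:R) - expR (- l * b%:R)|.
Proof.
move=> l0; wlog ab : a b / (a < b)%N => [H|_].
  rewrite neq_ltn => /orP[ab|ba]; first by apply: H => //; rewrite neq_ltn ab.
  by rewrite minnC distrC [leRHS]distrC H// neq_ltn ba.
rewrite (minn_idPl (ltnW ab)) distrC.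
have ab' : (a%:R : R) + 1 <= b%:R by rewrite -[1]/(1%:R) -natrD addn1 ler_nat.
rewrite ger0_norm ?subr_ge0; last lra.
have -> : expR (- l * b%:R) = expR (- l * a%:R) * expR (- l * (b%:R - a%:R)).
  by rewrite -expRD; congr expR; ring.
set y := expR (- l * (_ - _)); set q := expR (- l).
have q1 : q < 1 by rewrite /q expR_lt1 oppr_lt0.
have yq : y <= q by rewrite ler_expR; nra.
have y0 : 0 < y by exact: expR_gt0.
rewrite -[X in _ <= `|X - _|]mulr1 -mulrBr normrM ger0_norm ?expR_ge0//.
rewrite ler_wpM2l ?expR_ge0// ger0_norm ?subr_ge0; last lra.
rewrite expRN -[leRHS]invrK lef_pV2 ?posrE ?expR_gt0 ?invr_gt0 ?subr_gt0//; last lra.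
(* 1 / (1 - y) = 1 + y / (1 - y) <= exp (y / (1 - y)) *)
apply: le_trans (expR_ge1Dx _).
have -> : (1 - y)^-1 = 1 + (1 - y)^-1 * y by field; lra.
rewrite lerD2l ler_wpM2r ?(ltW y0)// lef_pV2 ?posrE ?subr_gt0//; lra.
Qed.

(** Lagrange interpolation at the nodes [exp (- l * i)], [0 <= i <= 2 N], with
    the [N]-th coefficient read off: a monomial [X ^ j] is reproduced by its
    values at the nodes, so the weights [w i] annihilate every [j != N].
    Numerator and denominator of a Lagrange polynomial are products over the
    same nodes, and on a geometric progression their quotient is a Gaussian in
    [i - N] up to a factor that depends on [l] only. *)
Lemma interpolation_weights (R : realType) (l : R) : 0 < l ->
  exists2 C, 0 < C & forall N : nat, exists D : int -> R,
    (forall m : int, (`|m| <= N)%N ->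
       \sum_(n <- zrange N) D n * expR (- l * n%:~R * m%:~R) = (m == 0)%:R) /\
    (forall n, n \in zrange N ->
       `|D n| <= C * expR (- l * ((n%:~R) ^+ 2 - `|n%:~R|) / 2)).
Proof.
move=> l0; have [K K0 hK] := sum_expR_abs_le l0.
pose q := expR (- l).
have q1 : q < 1 by rewrite /q expR_lt1 oppr_lt0.
exists (expR (K + (1 - q)^-1 * K)) => [|N]; first exact: expR_gt0.
(* Nodes are indexed by naturals; the integer index [n] of the weights is the
   natural index shifted by [N]. *)
pose M := N.*2.+1.
pose x (i : nat) := expR (- l * i%:R).
have M0 : (0 < M)%N by [].
have x_inj : injective x.
  move=> i j /expR_inj /mulfI; rewrite oppr_eq0 gt_eqF// => /(_ isT).
  by move/eqP; rewrite eqr_nat => /eqP.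
have NM : (N < M)%N by rewrite /M; lia.
pose w (i : 'I_M) := ((tnth (qpoly.lagrange M x) i : {poly R}))`_N.
have hw (j : nat) : (j < M)%N -> \sum_(i < M) w i * expR (- l * i%:R * j%:R) = (j == N)%:R.
  move=> jM; have sX : (size ('X^j : {poly R}) <= M)%N by rewrite size_polyXn.
  have /(congr1 (fun p : {poly R} => p`_N)) := lagrange_gen M0 x_inj sX.
  rewrite coefXn eq_sym coef_sum => ->; apply: eq_bigr => i _.
  by rewrite coefCM hornerXn /x -expRM_natr mulrC.
have w_le (i : 'I_M) : `|w i| * expR (- l * i%:R * N%:R) <=
    expR (K + (1 - q)^-1 * K) *
      expR (- l * ((i%:R - N%:R) ^+ 2 - `|i%:R - N%:R|) / 2).
  pose p : {poly R} := \prod_(j < M | j != i) ('X - (x j)%:P).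
  have px : p.[x i] = \prod_(j < M | j != i) (x i - x j).
    by rewrite horner_prod; apply: eq_bigr => j _; rewrite hornerXsubC.
  have -> : w i = (p.[x i])^-1 * p`_N by rewrite /w lagrangeE// coefCM.
  pose e1 (j : 'I_M) := expR (- l * `|N%:R - j%:R|).
  pose e2 (j : 'I_M) := expR (- l * `|i%:R - j%:R|).
  have e_le (k : nat) : \sum_(j < M | j != i) expR (- l * `|k%:R - j%:R|) <= K.
    apply: le_trans (hK [seq k%:Z - j%:Z | j <- index_iota 0 M] _); last first.
      by rewrite map_inj_uniq ?iota_uniq// => a b; lia.
    rewrite big_map big_mkord [leRHS](bigD1 i)//=.
    under [X in _ <= _ + X]eq_bigr do rewrite intrD rmorphN /=.
    by rewrite lerDr expR_ge0.
  have num : `|p`_N| * x N ^+ N <=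
      expR (\sum_(j < M | j != i) (- l * (minn N j)%:R + e1 j)).
    pose s := [seq x (nat_of_ord j) | j <- [seq j <- index_enum 'I_M | j != i]].
    have -> : p = \prod_(y <- s) ('X - y%:P) by rewrite big_map big_filter.
    apply: le_trans (coef_prod_XsubC_le _ _ _) _; first exact: expR_ge0.
      by move=> y /mapP[j _ ->]; exact: expR_ge0.
    rewrite big_map big_filter expR_sum; apply: ler_prod => j _.
    by rewrite addr_ge0 ?expR_ge0//= expRD; exact: geom_add_le.
  have den : expR (\sum_(j < M | j != i) (- l * (minn i j)%:R - (1 - q)^-1 * e2 j)) <=
      `|p.[x i]|.
    rewrite px normr_prod expR_sum; apply: ler_prod => j ji.
    rewrite expR_ge0/= expRD; apply: geom_sub_ge => //.
    by rewrite eq_sym; apply: contra ji => /eqP/val_inj ->.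
  rewrite normrM normfV.
  have den0 := lt_le_trans (expR_gt0 _) den.
  rewrite -[leLHS]mulrA ler_pdivrMl//.
  have xN0 : 0 < x N ^+ N by rewrite exprn_gt0// expR_gt0.
  rewrite -(ler_pM2r xN0) mulrAC.
  apply: le_trans (_ : _ <= expR (\sum_(j < M | j != i) (- l * (minn N j)%:R + e1 j))
     * expR (- l * i%:R * N%:R)) _; first by rewrite ler_wpM2r// expR_ge0.
  apply: le_trans (_ : _ <= expR (\sum_(j < M | j != i)
      (- l * (minn i j)%:R - (1 - q)^-1 * e2 j)) * (expR (K + (1 - q)^-1 * K) *
      expR (- l * ((i%:R - N%:R) ^+ 2 - `|i%:R - N%:R|) / 2)) * x N ^+ N) _; last first.
    by rewrite ler_wpM2r ?(ltW xN0)// ler_wpM2r// mulr_ge0 ?expR_ge0.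
  (* Both sides are exponentials; up to the sums of the [e1 j] and [e2 j], at
     most [K] each, the comparison of the exponents is [sum_minn] for [N] and
     for [i]. *)
  rewrite -expRM_natr -!expRD ler_expR big_split/= sumrB -!mulr_sumr.
  have E1K : \sum_(j < M | j != i) e1 j <= K := e_le N.
  have E2K : \sum_(j < M | j != i) e2 j <= K := e_le i.
  move: E1K E2K; move: (\sum_(j < M | j != i) e1 j) => E1.
  move: (\sum_(j < M | j != i) e2 j) => E2 E1K E2K.
  have {}E2K : (1 - q)^-1 * E2 <= (1 - q)^-1 * K.
    by rewrite ler_wpM2l// invr_ge0 subr_ge0 ltW.
  have S k : (k <= M)%N -> 2 * \sum_(j < M | j != i) (minn k j)%:R =
      2 * k%:R * M%:R - k%:R * (k%:R + 1) - 2 * (minn k i)%:R :> R.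
    move=> kM; have /(congr1 (fun n => n%:R : R)) := sum_minn k (M - k).
    rewrite subnKC//.
    rewrite (bigD1 i) //=.
    rewrite natrD natrM natrD natr_sum.
    rewrite !natrM -addn1 natrD.
    move=> <-.
    rewrite mulrDl.
    ring.
  have := S N (ltnW NM); have := S i (ltnW (ltn_ord i)).
  rewrite minnn -!natr_sum; set SI : R := (\sum_(_ < _ | _) _)%:R.
  set SN : R := (\sum_(_ < _ | _) _)%:R.
  have -> : M%:R = 2 * N%:R + 1 :> R by rewrite /M -addn1 natrD -muln2 natrM mulrC.
  have iN : `|(i%:R : R) - N%:R| = i%:R + N%:R - 2 * (minn N i)%:R.
    have /orP[iN|iN] := leq_total i N.
      by rewrite (minn_idPr iN) distrC ger0_norm ?subr_ge0 ?ler_nat//; ring.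
    by rewrite (minn_idPl iN) ger0_norm ?subr_ge0 ?ler_nat//; ring.
  rewrite iN => hI hN.
  have m1 : (minn N i)%:R <= i%:R :> R by rewrite ler_nat geq_minr.
  have m2 : (minn N i)%:R <= N%:R :> R by rewrite ler_nat geq_minl.
  have {}m1 : 0 <= l * (i%:R - (minn N i)%:R) by rewrite mulr_ge0 ?(ltW l0)// subr_ge0.
  have {}m2 : 0 <= l * (N%:R - (minn N i)%:R) by rewrite mulr_ge0 ?(ltW l0)// subr_ge0.
  have {}hI := congr1 (fun z => l * z / 2) hI.
  have {}hN := congr1 (fun z => l * z / 2) hN.
  clear - E1K E2K m1 m2 hI hN.
  move: (1 - q)^-1 E2K => c E2K.
  rewrite /= in hI hN; lra.
pose D (n : int) : R := w (inord (absz (n + N%:Z))) * expR (- l * (n%:~R + N%:R) * N%:R).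
exists D; split=> [m mN|n]; last first.
  rewrite mem_zrange => nN.
  have inM : (absz (n + N%:Z)%R < M)%N by rewrite /M; lia.
  have E : (inord (absz (n + N%:Z)) : 'I_M)%:R = n%:~R + N%:R :> R.
    rewrite inordK// [LHS]pmulrn [N%:R]pmulrn -intrD; congr (_ %:~R); lia.
  rewrite /D normrM (ger0_norm (expR_ge0 _)) -E; apply: le_trans (w_le _) _.
  by rewrite E addrK.
have mE : (absz (m + N%:Z)%R < M)%N by rewrite /M; lia.
have E : (absz (m + N%:Z))%:R = m%:~R + N%:R :> R.
  rewrite [LHS]pmulrn [N%:R]pmulrn -intrD; congr (_ %:~R); lia.
rewrite /zrange big_map big_mkord.
have -> : (m == 0)%:R = expR (l * N%:R * m%:~R) * (absz (m + N%:Z) == N)%:R.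
  have -> : (absz (m + N%:Z) == N) = (m == 0) by lia.
  by case: eqP => [->|_]; rewrite ?mulr0// expR0 mulr1.
rewrite -hw// mulr_sumr; apply: eq_bigr => i _.
rewrite /D; have -> : (i%:Z - N%:Z + N%:Z) = i%:Z by ring.
rewrite /= inord_val mulrCA -[LHS]mulrA -!expRD E; congr (_ * expR _).
rewrite intrD mulrNz -!pmulrn; ring.
Qed.

(** * Sampling sums of shifted Gaussians *)

Definition gauss (R : realType) (g x : R) : R := expR (- g * x ^+ 2).

Lemma quadratic_absorbs (R : realType) (a b : R) : 0 < a ->
  exists C, forall t, - a * t ^+ 2 + b * t <= C - t.
Proof.
move=> a0; exists ((b + 1) ^+ 2 / (4 * a)) => t.
rewrite -subr_ge0 (_ : _ - _ = a * (t - (b + 1) / (2 * a)) ^+ 2); last first.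
  by field; lra.
by rewrite mulr_ge0 ?sqr_ge0// ltW.
Qed.

Lemma floor_mod (R : realType) (h x : R) : 0 < h ->
  0 <= x - (Num.floor (x / h))%:~R * h < h.
Proof.
move=> h0; have /andP[h1 h2] := floor_itv (x / h).
rewrite intrD in h2; apply/andP; split.
  by rewrite subr_ge0 -ler_pdivlMr.
by move: h2; rewrite ltr_pdivrMr// => h2; lra.
Qed.

(** Shifting the index by the integer part of [x / s] makes the bound uniform in
    [x]. *)
Lemma gauss_sum_le (R : realType) (g s : R) : 0 < g -> 0 < s ->
  exists2 K, 0 < K & forall (x : R) (r : seq int), uniq r ->
    \sum_(k <- r) gauss g (x + k%:~R * s) <= K.
Proof.
move=> g0 s0; have [K K0 hK] := sum_expR_abs_le (ltr01 : 0 < (1 : R)).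
have a0 : 0 < g * s ^+ 2 by rewrite mulr_gt0// exprn_gt0.
have [C hC] := quadratic_absorbs (2 * g * s ^+ 2) a0.
exists (expR C * K) => [|x r ur]; first by rewrite mulr_gt0// expR_gt0.
pose m := Num.floor (x / s).
have /andP[y0 ys] := floor_mod x s0; rewrite -/m in y0 ys.
have ub : uniq [seq k + m | k <- r] by rewrite map_inj_uniq// => i j; lia.
apply: le_trans (_ : _ <= expR C * \sum_(n <- [seq k + m | k <- r]) expR (- 1 * `|n%:~R|)) _.
  rewrite big_map mulr_sumr; apply: ler_sum => k _.
  rewrite -expRD ler_expR mulN1r; apply: le_trans (hC _).
  have -> : x + k%:~R * s = (k + m)%:~R * s + (x - m%:~R * s) by rewrite intrD; ring.
  set y := x - _ in y0 ys *; set n : R := (k + m)%:~R.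
  have := ler_norm n; have := ler_norm (- n); rewrite normrN => n1 n2.
  rewrite (real_normK (num_real n)) -subr_ge0.
  have -> : - (g * s ^+ 2) * n ^+ 2 + 2 * g * s ^+ 2 * `|n| - - g * (n * s + y) ^+ 2
    = g * (2 * s * (s * `|n| + n * y) + y ^+ 2) by ring.
  rewrite mulr_ge0 ?(ltW g0)// addr_ge0 ?sqr_ge0// !mulr_ge0 ?(ltW s0)//.
  have : 0 <= (`|n|) * (s - y) by rewrite mulr_ge0// subr_ge0 ltW.
  nra.
by rewrite ler_wpM2l ?expR_ge0// hK.
Qed.

(** Schur's test for a nonnegative matrix, by Cauchy-Schwarz with the matrix
    itself as the weight. *)
Lemma schur_le (R : realType) (I J : eqType) (r : seq I) (F : seq J)
    (M : I -> J -> R) (c : I -> R) (K1 K2 : R) :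
  0 < K1 -> (forall k n, 0 <= M k n) ->
  (forall n, \sum_(k <- r) M k n <= K1) ->
  (forall k, \sum_(n <- F) M k n <= K2) ->
  \sum_(n <- F) (\sum_(k <- r) c k * M k n) ^+ 2 <=
  K1 * K2 * \sum_(k <- r) c k ^+ 2.
Proof.
move=> K10 M0 h1 h2.
apply: le_trans (_ : _ <= \sum_(n <- F) K1 * \sum_(k <- r) c k ^+ 2 * M k n) _.
  apply: ler_sum => n _; set S := \sum_(_ <- _) _ * _.
  (* 2 c S <= K1 c^2 + S^2 / K1, weighted by [M k n] *)
  have : (\sum_(k <- r) c k * M k n) * S <= (\sum_(k <- r) c k ^+ 2 * M k n) * (K1 / 2) +
       (\sum_(k <- r) M k n) * (S ^+ 2 / (2 * K1)).
    rewrite !mulr_suml -big_split/=; apply: ler_sum => k _.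
    rewrite -subr_ge0 (_ : _ - _ = M k n * (c k * K1 - S) ^+ 2 / (2 * K1)); last first.
      by field; lra.
    by apply: divr_ge0; [exact: mulr_ge0 (M0 _ _) (sqr_ge0 _)|lra].
  rewrite -/S; set U := \sum_(k <- r) c k ^+ 2 * M k n; move=> H.
  have : (\sum_(k <- r) M k n) * (S ^+ 2 / (2 * K1)) <= K1 * (S ^+ 2 / (2 * K1)).
    by rewrite ler_wpM2r//; apply: divr_ge0; [exact: sqr_ge0|lra].
  have -> : K1 * (S ^+ 2 / (2 * K1)) = S ^+ 2 / 2 by field; lra.
  lra.
rewrite -mulr_sumr -mulrA ler_wpM2l ?(ltW K10)// exchange_big/= mulr_sumr.
by apply: ler_sum => k _; rewrite -mulr_sumr mulrC ler_wpM2r ?sqr_ge0.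
Qed.

Lemma sampling_upper (R : realType) (g s h : R) : 0 < g -> 0 < s -> 0 < h ->
  exists2 B, 0 < B & forall (r F : seq int) (c : int -> R) (x : R),
    uniq r -> uniq F ->
    \sum_(n <- F) (\sum_(k <- r) c k * gauss g (x + k%:~R * s - n%:~R * h)) ^+ 2 <=
    B * \sum_(k <- r) c k ^+ 2.
Proof.
move=> g0 s0 h0; have [K1 K10 hK1] := gauss_sum_le g0 s0.
have [K2 K20 hK2] := gauss_sum_le g0 h0.
exists (K1 * K2) => [|r F c x ur uF]; first exact: mulr_gt0.
apply: (schur_le (M := fun k n : int => gauss g (x + k%:~R * s - n%:~R * h))) => //.
- by move=> *; exact: expR_ge0.
- by move=> n; under eq_bigr do rewrite addrAC; exact: hK1.
- move=> k; apply: le_trans (hK2 (- (x + k%:~R * s)) F uF).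
  apply: ler_sum => n _; rewrite /gauss -(sqrrN (- _ + _)).
  by rewrite opprD opprK.
Qed.

(** The matrix [M] inverts the sampling matrix: row [k] carries the weights of
    [interpolation_weights], centred at the sample closest to [k * s].  The
    Gaussian decay of the weights has rate [h * s], which beats the growth of rate
    [h ^+ 2] of the inverse Gaussian precisely because [h < s]. *)
Lemma sampling_lower (R : realType) (g s h : R) : 0 < g -> 0 < h -> h < s ->
  exists2 A, 0 < A & forall (r : seq int) (L : R), uniq r ->
    exists2 F : seq int, uniq F & forall (c : int -> R) (x : R), `|x| <= L ->
    A * \sum_(k <- r) c k ^+ 2 <=
    \sum_(n <- F) (\sum_(k <- r) c k * gauss g (x + k%:~R * s - n%:~R * h)) ^+ 2.
Proof.
move=> g0 h0 hs; have s0 := lt_trans h0 hs.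
have l0 : 0 < 2 * g * h * s by rewrite !mulr_gt0.
have [C C0 hC] := interpolation_weights l0.
have [K K0 hK] := sum_expR_abs_le (ltr01 : 0 < (1 : R)).
have a0 : 0 < g * h * (s - h) by rewrite !mulr_gt0// subr_gt0.
have [C1 hC1] := quadratic_absorbs (g * h * s + 2 * g * h ^+ 2) a0.
pose C2 := C * expR (C1 + g * h ^+ 2).
have C20 : 0 < C2 by rewrite mulr_gt0 ?expR_gt0.
pose K' := C2 * K.
have K'0 : 0 < K' by exact: mulr_gt0.
exists (K' ^+ 2)^-1 => [|r L ur]; first by rewrite invr_gt0 exprn_gt0.
have [N0 rN0] := exists_zrange r.
have [D [D_dual D_le]] := hC N0.*2.
pose N1 := Num.truncn ((L + N0%:R * s) / h).
(* [N1 + 2] bounds the samples [nn k] next to the centres, and [N0.*2] the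
   differences of two indices in [r]. *)
exists (zrange (N1 + N0.*2 + 2)); first exact: zrange_uniq.
move=> c x xL; set F := zrange _.
pose H n := \sum_(k <- r) c k * gauss g (x + k%:~R * s - n%:~R * h).
rewrite -/H.
pose nn (k : int) := Num.floor ((x + k%:~R * s) / h).
pose y (k : int) := x + k%:~R * s - (nn k)%:~R * h.
have yP k : 0 <= y k < h by exact: floor_mod.
(* Dividing by the [k]-th Gaussian turns the [j]-th one into
   [exp (2 * g * h * s * n * (j - k))] up to a factor free of [n]. *)
pose d k (n : int) := D n * expR (g * (y k - n%:~R * h) ^+ 2).
pose M k (n : int) := if n - nn k \in zrange N0.*2 then d k (n - nn k) else 0.
have d_le k n : n \in zrange N0.*2 -> `|d k n| <= C2 * expR (- 1 * `|n%:~R|).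
  move=> /D_le; rewrite /d normrM (ger0_norm (expR_ge0 _)) => Dn.
  apply: le_trans (ler_wpM2r (expR_ge0 _) Dn) _.
  rewrite /C2 -!mulrA (ler_pM2l C0) -!expRD ler_expR.
  have := hC1 `|n%:~R|; have /andP[y0 yh] := yP k.
  rewrite -(real_normK (num_real (n%:~R : R))).
  rewrite -(real_normK (num_real (y k - n%:~R * h))).
  set t : R := `|n%:~R| => ht.
  have t0 : 0 <= t by exact: normr_ge0.
  have : `|y k - n%:~R * h| <= h * (1 + t).
    apply: le_trans (ler_normB _ _) _; rewrite normrM -/t (ger0_norm y0) (gtr0_norm h0).
    by nra.
  move=> hy; have {}hy : `|y k - n%:~R * h| ^+ 2 <= (h * (1 + t)) ^+ 2.
    by rewrite ler_sqr ?nnegrE// mulr_ge0 ?(ltW h0)//; lra.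
  have {}hy : g * `|y k - n%:~R * h| ^+ 2 <= g * (h * (1 + t)) ^+ 2.
    by rewrite ler_wpM2l// ltW.
  by nra.
have M_le k n : `|M k n| <= C2 * expR (- 1 * `|(n - nn k)%:~R|).
  rewrite /M; case: ifPn => [/d_le//|_].
  by rewrite normr0 mulr_ge0 ?expR_ge0// ltW.
have row k : \sum_(n <- F) `|M k n| <= K'.
  apply: le_trans (ler_sum _ (fun n _ => M_le k n)) _.
  rewrite -mulr_sumr ler_pM2l// -(big_map (fun n => n - nn k) predT (fun n : int => expR (- 1 * `|n%:~R|))).
  by apply: hK; rewrite map_inj_uniq ?zrange_uniq// => i j /addIr.
have nn_inj : injective nn.
  move=> i j ij; apply/eqP; rewrite eq_le; apply/andP.
  have := yP i; have := yP j; rewrite /y ij => /andP[j1 j2] /andP[i1 i2].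
  have H1 (a b : int) : x + a%:~R * s - (nn j)%:~R * h < h ->
     0 <= x + b%:~R * s - (nn j)%:~R * h -> a <= b.
    move=> h1 h2; rewrite leNgt; apply/negP => ba.
    have : (b%:~R : R) + 1 <= a%:~R by rewrite -[1]/(1%:~R) -intrD ler_int lezD1.
    by nra.
  by split; apply: H1.
have col n : \sum_(k <- r) `|M k n| <= K'.
  apply: le_trans (ler_sum _ (fun k _ => M_le k n)) _.
  rewrite -mulr_sumr ler_pM2l// -(big_map (fun k => n - nn k) predT (fun n : int => expR (- 1 * `|n%:~R|))).
  by apply: hK; rewrite map_inj_uniq// => i j /addrI/oppr_inj/nn_inj.
have inv k : k \in r -> \sum_(n <- F) M k n * H n = c k.
  move=> kr; have k0 : `|k%:~R : R| <= N0%:R.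
    by have := rN0 k kr; rewrite mem_zrange -intr_norm -abszE -pmulrn ler_nat.
  have nn_le : (`|nn k|%N <= N1 + 2)%N.
    have z0 : `|(x + k%:~R * s) / h| <= (L + N0%:R * s) / h.
      rewrite normrM (gtr0_norm (_ : 0 < h^-1)) ?invr_gt0// ler_pM2r ?invr_gt0//.
      apply: le_trans (ler_normD _ _) _; rewrite lerD// normrM (gtr0_norm s0).
      by rewrite ler_wpM2r// ltW.
    have z1 : (L + N0%:R * s) / h < N1.+1%:R.
      by have /andP[] := truncn_itv (le_trans (normr_ge0 _) z0).
    rewrite -(ler_nat R) [in leLHS]pmulrn abszE intr_norm ler_norml.
    have /andP[f1 f2] := floor_itv ((x + k%:~R * s) / h).
    rewrite -/(nn k) intrD in f1 f2.
    move: z0; rewrite ler_norml => /andP[z2 z3].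
    rewrite natrD; rewrite -addn1 natrD in z1; apply/andP; split; lra.
  have -> : \sum_(n <- F) M k n * H n = \sum_(m <- zrange N0.*2) d k m * H (m + nn k).
    rewrite (bigID (fun n => n - nn k \in zrange N0.*2))/= [X in _ + X]big1 ?addr0.
      rewrite -big_filter (perm_big [seq m + nn k | m <- zrange N0.*2]).
        rewrite big_map big_seq [RHS]big_seq; apply: eq_bigr => m mr.
        by rewrite /M addrK mr.
      apply: uniq_perm; first by rewrite filter_uniq// zrange_uniq.
        by rewrite map_inj_uniq ?zrange_uniq// => i j /addIr.
      move=> n; rewrite mem_filter; apply/andP/mapP => [[n1 n2]|[m mr ->]].
        by exists (n - nn k); rewrite ?subrK.
      split; first by rewrite addrK.
      move: mr nn_le; rewrite /F !mem_zrange; clear; lia.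
    by move=> n /negPf nr; rewrite /M nr mul0r.
  transitivity (\sum_(j <- r) c j * expR (- (2 * g * y k * (j - k)%:~R * s)
      - g * ((j - k)%:~R * s) ^+ 2) * (k - j == 0)%:R).
    under eq_bigr do rewrite mulr_sumr.
    rewrite exchange_big/= big_seq [RHS]big_seq; apply: eq_bigr => j jr.
    rewrite -(D_dual (k - j)); last first.
      have := rN0 _ jr; have := rN0 _ kr; rewrite !mem_zrange; clear; lia.
    rewrite mulr_sumr; apply: eq_bigr => m _.
    rewrite /d /gauss -[RHS]mulrA [LHS]mulrCA; congr (c j * _).
    rewrite [RHS]mulrCA -[LHS]mulrA; congr (D m * _); rewrite -!expRD; congr expR.
    rewrite /y !intrD !mulrNz; ring.
  rewrite (bigD1_seq k)//= [X in _ + X]big1 ?addr0.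
    by rewrite !subrr eqxx mulr1 /= mulr0 mul0r expr0n/= mulr0 subr0 oppr0 expR0 mulr1.
  by move=> j jk; rewrite subr_eq0 eq_sym (negPf jk) mulr0.
(* c = M H, so that the sum of c^2 is the double sum of c M H; Young's inequality
   and the bounds on the rows and columns of [M] finish the proof. *)
have : \sum_(k <- r) c k ^+ 2 <=
   (\sum_(k <- r) c k ^+ 2) / 2 + K' ^+ 2 / 2 * \sum_(n <- F) H n ^+ 2.
  apply: le_trans (_ : _ <= \sum_(k <- r) \sum_(n <- F)
      (c k ^+ 2 / (2 * K') * `|M k n| + K' / 2 * H n ^+ 2 * `|M k n|)) _.
    rewrite big_seq [leRHS]big_seq; apply: ler_sum => k kr.
    rewrite [leLHS]expr2 -[X in _ * X <= _](inv k kr) mulr_sumr; apply: ler_sum => n _.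
    apply: le_trans (ler_norm _) _; rewrite !normrM.
    rewrite -subr_ge0 -(real_normK (num_real (c k))) -(real_normK (num_real (H n))).
    rewrite (_ : _ - _ = `|M k n| * (`|c k| - K' * `|H n|) ^+ 2 / (2 * K')); last first.
      by field; lra.
    by apply: divr_ge0; [exact: mulr_ge0 (normr_ge0 _) (sqr_ge0 _)|lra].
  under eq_bigr do rewrite big_split/=.
  rewrite big_split/=; apply: lerD.
    rewrite mulr_suml; apply: ler_sum => k _; rewrite -mulr_sumr.
    apply: le_trans (ler_wpM2l _ (row k)) _.
      by apply: divr_ge0; [exact: sqr_ge0|lra].
    by rewrite le_eqVlt; apply/orP; left; apply/eqP; field; lra.
  rewrite exchange_big/= mulr_sumr; apply: ler_sum => n _; rewrite -mulr_sumr.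
  apply: le_trans (ler_wpM2l _ (col n)) _.
    by rewrite mulr_ge0 ?sqr_ge0// mulr_ge0// ltW.
  by rewrite le_eqVlt; apply/orP; left; apply/eqP; ring.
by rewrite ler_pdivrMl ?exprn_gt0// => ?; lra.
Qed.

(** * From one variable to the sheared planar lattice *)

(** The columns of [K x y] form a Riesz sequence, uniformly in the offset
    [(x, y)].  In the lower bound the finite set [F] of samples is chosen before
    the coefficients and the offset, so that the inequality may be integrated
    over a bounded set of offsets. *)
Definition stable_sampling (R : realType)
    (K : R -> R -> int * int -> int * int -> R) : Prop :=
  (exists2 B, 0 < B & forall (r F : seq (int * int)) (c : int * int -> R) (x y : R),
    uniq r -> uniq F ->
    \sum_(t <- F) (\sum_(j <- r) c j * K x y j t) ^+ 2 <=
    B * \sum_(j <- r) c j ^+ 2) /\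
  (exists2 A, 0 < A & forall (r : seq (int * int)) (L : R), uniq r ->
    exists2 F : seq (int * int), uniq F &
      forall (c : int * int -> R) (x y : R), `|x| <= L -> `|y| <= L ->
      A * \sum_(j <- r) c j ^+ 2 <=
      \sum_(t <- F) (\sum_(j <- r) c j * K x y j t) ^+ 2).

Lemma stable_sampling_reindex (R : realType)
    (K K' : R -> R -> int * int -> int * int -> R)
    (f f' h h' : int * int -> int * int) :
  cancel f f' -> cancel h h' -> cancel h' h ->
  (forall x y j t, K' x y j t = K x y (f j) (h t)) ->
  stable_sampling K -> stable_sampling K'.
Proof.
move=> ff' hh' h'h KE [[B B0 hB] [A A0 hA]].
have sumE r c : \sum_(j <- r) c j ^+ 2 = \sum_(j <- map f r) c (f' j) ^+ 2 :> R.
  by rewrite big_map; apply: eq_bigr => j _; rewrite ff'.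
have coefE x y r c t : \sum_(j <- r) c j * K' x y j t =
    \sum_(j <- map f r) c (f' j) * K x y j (h t).
  by rewrite big_map; apply: eq_bigr => j _; rewrite ff' KE.
split.
  exists B => // r F c x y ur uF.
  under eq_bigr do rewrite coefE.
  rewrite sumE -(big_map h predT (fun t => (\sum_(j <- _) _ * K x y j t) ^+ 2)).
  by apply: hB; rewrite map_inj_uniq//; exact: can_inj.
exists A => // r L ur.
have [|F uF hF] := hA (map f r) L; first by rewrite map_inj_uniq//; exact: can_inj ff'.
exists (map h' F) => [|c x y xL yL]; first by rewrite map_inj_uniq//; exact: can_inj h'h.
rewrite sumE; apply: le_trans (hF _ _ _ xL yL) _; rewrite big_map.
by apply: ler_sum => t _; rewrite coefE h'h.
Qed.

Lemma stable_sampling_swap (R : realType) (K K' : R -> R -> int * int -> int * int -> R) :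
  (forall x y j t, K' x y j t = K y x j t) -> stable_sampling K -> stable_sampling K'.
Proof.
move=> KE [[B B0 hB] [A A0 hA]]; split.
  exists B => // r F c x y ur uF; apply: le_trans (hB r F c y x ur uF).
  by apply: ler_sum => t _; under eq_bigr do rewrite KE.
exists A => // r L ur; have [F uF hF] := hA r L ur; exists F => // c x y xL yL.
apply: le_trans (hF c y x yL xL) _.
by apply: ler_sum => t _; under [X in _ <= X ^+ 2]eq_bigr do rewrite KE.
Qed.

Lemma sum_zrange2 (R : realType) (r : seq (int * int)) (N : nat)
    (c : int * int -> R) (F : R -> int * int -> R) :
  uniq r -> (forall j, j \in r -> (j.1 \in zrange N) && (j.2 \in zrange N)) ->
  (forall j, F 0 j = 0) ->
  \sum_(j <- r) F (c j) j =
  \sum_(a <- zrange N) \sum_(b <- zrange N)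
     F (if (a, b) \in r then c (a, b) else 0) (a, b).
Proof.
move=> ur rN F0.
rewrite -(big_allpairs_dep (h := fun a b : int => (a, b))
  (F := fun j => F (if j \in r then c j else 0) j))/=.
rewrite [RHS](bigID (mem r))/= [X in _ + X]big1 ?addr0; last first.
  by move=> j /negPf ->; rewrite F0.
have Hp : perm_eq [seq j <- [seq (x, y) | x <- zrange N, y <- zrange N] | j \in r] r.
  apply: uniq_perm => //.
    by rewrite filter_uniq// allpairs_pair_uniq ?zrange_uniq.
  move=> -[a b]; rewrite mem_filter.
  have [abr|//] := boolP ((a, b) \in r).
  have /andP[a1 b1] := rN _ abr.
  by rewrite (allpairs_f pair a1 b1).
rewrite -[RHS]big_filter (perm_big r Hp).
by rewrite [LHS]big_seq [RHS]big_seq; apply: eq_bigr => j ->.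
Qed.

(** The first factor depends on [j.1] and [t.1] only.  For fixed [j.1] the
    coefficients of the inner sum over [j.2] face a one-dimensional problem
    whose offset [y + j.1 * rho] is harmless because the one-dimensional bounds
    are uniform in the offset. *)
Lemma stable_sampling_sheared (R : realType) (g s1 h1 s2 h2 rho : R) :
  0 < g -> 0 < h1 < s1 -> 0 < h2 < s2 ->
  stable_sampling (fun x y (j t : int * int) =>
    gauss g (x + j.1%:~R * s1 - t.1%:~R * h1) *
    gauss g (y + j.1%:~R * rho + j.2%:~R * s2 - t.2%:~R * h2)).
Proof.
move=> g0 /andP[h10 hs1] /andP[h20 hs2].
have s10 := lt_trans h10 hs1; have s20 := lt_trans h20 hs2.
pose G1 x (a m : int) := gauss g (x + a%:~R * s1 - m%:~R * h1).
pose G2 y (a b n : int) := gauss g (y + a%:~R * rho + b%:~R * s2 - n%:~R * h2).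
pose c0 (r : seq (int * int)) (c : int * int -> R) a b := if (a, b) \in r then c (a, b) else 0.
pose inner r c N y n a := \sum_(b <- zrange N) c0 r c a b * G2 y a b n.
have coefE r N c x y m n : uniq r ->
    (forall j, j \in r -> (j.1 \in zrange N) && (j.2 \in zrange N)) ->
    \sum_(j <- r) c j * (gauss g (x + j.1%:~R * s1 - m%:~R * h1) *
      gauss g (y + j.1%:~R * rho + j.2%:~R * s2 - n%:~R * h2)) =
    \sum_(a <- zrange N) inner r c N y n a * G1 x a m.
  move=> ur rN; rewrite (sum_zrange2 c (F := fun z j => z * (G1 x j.1 m * G2 y j.1 j.2 n)) ur rN).
    by apply: eq_bigr => a _; rewrite mulr_suml; apply: eq_bigr => b _; rewrite mulrCA mulrC mulrAC.
  by move=> j; rewrite mul0r.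
have sqE r N c : uniq r ->
    (forall j, j \in r -> (j.1 \in zrange N) && (j.2 \in zrange N)) ->
    \sum_(j <- r) c j ^+ 2 = \sum_(a <- zrange N) \sum_(b <- zrange N) c0 r c a b ^+ 2.
  move=> ur rN; apply: (sum_zrange2 c (F := fun z _ => z ^+ 2) ur rN).
  by move=> j; rewrite expr0n.
split.
  have [B1 B10 hB1] := sampling_upper g0 s10 h10.
  have [B2 B20 hB2] := sampling_upper g0 s20 h20.
  exists (B1 * B2) => [|r F c x y ur uF]; first exact: mulr_gt0.
  have [N rN] := exists_zrange2 r; have [M FM] := exists_zrange2 F.
  apply: le_trans (ler_sum_sub (t := [seq (m, n) | m <- zrange M, n <- zrange M])
     uF _ _ (fun _ => sqr_ge0 _)) _.
  - by rewrite allpairs_pair_uniq ?zrange_uniq.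
  - by move=> -[m n] /FM /andP[m1 n1]; rewrite (allpairs_f pair m1 n1).
  rewrite big_allpairs_dep/= exchange_big/= (sqE r N)//.
  apply: le_trans (_ : _ <= \sum_(n <- zrange M) B1 * \sum_(a <- zrange N) inner r c N y n a ^+ 2) _.
    apply: ler_sum => n _; under eq_bigr do rewrite (coefE r N)//.
    by apply: hB1; exact: zrange_uniq.
  rewrite -mulr_sumr -mulrA ler_pM2l// exchange_big/= mulr_sumr.
  by apply: ler_sum => a _; apply: hB2; exact: zrange_uniq.
have [A1 A10 hA1] := sampling_lower g0 h10 hs1.
have [A2 A20 hA2] := sampling_lower g0 h20 hs2.
exists (A1 * A2) => [|r L ur]; first exact: mulr_gt0.
have [N rN] := exists_zrange2 r.
have [F1 uF1 hF1] := hA1 (zrange N) L (zrange_uniq _).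
have [F2 uF2 hF2] := hA2 (zrange N) (L + N%:R * `|rho|) (zrange_uniq _).
exists [seq (m, n) | m <- F1, n <- F2]; first exact: allpairs_pair_uniq.
move=> c x y xL yL.
rewrite big_allpairs_dep/= exchange_big/= (sqE r N)//.
apply: le_trans (_ : \sum_(n <- F2) A1 * \sum_(a <- zrange N) inner r c N y n a ^+ 2 <= _).
  rewrite -mulr_sumr -mulrA ler_pM2l// [leRHS]exchange_big/= mulr_sumr.
  rewrite [leLHS]big_seq [leRHS]big_seq; apply: ler_sum => a aN; apply: hF2.
  apply: le_trans (ler_normD _ _) _; rewrite lerD// normrM ler_wpM2r//.
  by move: aN; rewrite mem_zrange -intr_norm -abszE -pmulrn ler_nat.
apply: ler_sum => n _; under [leRHS]eq_bigr do rewrite (coefE r N)//.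
exact: hF1.
Qed.

Lemma norm_pq_gt0 (R : realType) (p q : int) : coprimez p q ->
  0 < p%:~R ^+ 2 + q%:~R ^+ 2 :> R.
Proof.
move=> /coprimezP[[u v] /= uv].
rewrite lt0r addr_ge0 ?sqr_ge0// andbT paddr_eq0 ?sqr_ge0// !sqrf_eq0 !intr_eq0.
by apply/negP => /andP[/eqP p0 /eqP q0]; move: uv; rewrite p0 q0 !mulr0.
Qed.

(** The vectors [(p j1 + q j2, - q j1 + p j2)] form a sublattice of index
    [p ^+ 2 + q ^+ 2] of the integer lattice, each of whose coordinates takes all
    integer values because [p] and [q] are coprime.  In a basis with one vector
    along the second axis it is sheared as in [stable_sampling_sheared], and the
    steps are small enough under condition (i); with one vector along the first
    axis, under condition (ii). *)
Lemma stable_sampling_rotated (R : realType) (p q : int) (g c d : R) :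
  coprimez p q -> 0 < g -> 0 < c -> 0 < d ->
  let sigma := Num.sqrt (p%:~R ^+ 2 + q%:~R ^+ 2) in
  (c < 1 /\ d < 1) \/ (c < sigma ^+ 2 /\ d < sigma ^- 2) ->
  stable_sampling (fun x y (j t : int * int) =>
    gauss g (x + (p * j.1 + q * j.2)%:~R / sigma - t.1%:~R * (c / sigma)) *
    gauss g (y + (- q * j.1 + p * j.2)%:~R / sigma - t.2%:~R * (d * sigma))).
Proof.
move=> pq g0 c0 d0 sigma.
have /coprimezP[[u v] /= uv] := pq.
have S0 := norm_pq_gt0 R pq.
have sg0 : 0 < sigma by rewrite sqrtr_gt0.
have sgE : sigma ^+ 2 = p%:~R ^+ 2 + q%:~R ^+ 2 by rewrite sqr_sqrtr// ltW.
have sgV : sigma * sigma ^-1 = 1 by rewrite divff// gt_eqF.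
have csg : 0 < c / sigma by rewrite divr_gt0.
have dsg : 0 < d * sigma by rewrite mulr_gt0.
have sgV0 : 0 < sigma^-1 by rewrite invr_gt0.
case=> [[c1 d1]|[c1 d1]].
- pose K := fun x y (j t : int * int) =>
    gauss g (x + j.1%:~R * sigma^-1 - t.1%:~R * (c / sigma)) *
    gauss g (y + j.1%:~R * ((p * v - q * u)%:~R / sigma) + j.2%:~R * sigma -
             t.2%:~R * (d * sigma)).
  apply: (@stable_sampling_reindex _ K _
    (fun j => (p * j.1 + q * j.2, - v * j.1 + u * j.2))
    (fun n => (u * n.1 - q * n.2, v * n.1 + p * n.2)) id id) => //.
  + move=> [j1 j2] /=; congr pair.
      by rewrite -[RHS]mul1r -uv; ring.
    by rewrite -[RHS]mul1r -uv; ring.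
  + move=> x y [j1 j2] [t1 t2]; rewrite /K /=; congr (gauss g _ * gauss g _).
    congr (_ - _); rewrite -addrA; congr (_ + _).
    (* Bezout's relation [u * p + v * q = 1] *)
    have E : - q * j1 + p * j2 = (p * j1 + q * j2) * (p * v - q * u) +
        (- v * j1 + u * j2) * (p ^+ 2 + q ^+ 2).
      by rewrite -[LHS]mul1r -uv; ring.
    have E' : (- q * j1 + p * j2)%:~R =
        (p * j1 + q * j2)%:~R * (p * v - q * u)%:~R + (- v * j1 + u * j2)%:~R * sigma ^+ 2 :> R.
      rewrite [in LHS]E sgE; move: (p * j1 + q * j2) (p * v - q * u) (- v * j1 + u * j2) => e1 e2 e3.
      by rewrite intrD !intrM intrD !rmorphXn.
    by rewrite E'; field; rewrite gt_eqF.
  + apply: stable_sampling_sheared => //; apply/andP; split=> //.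
      by rewrite -[ltRHS]mul1r ltr_pM2r.
    by rewrite -[ltRHS]mul1r ltr_pM2r.
- pose K := fun x y (j t : int * int) =>
    gauss g (x + j.1%:~R * sigma^-1 - t.1%:~R * (d * sigma)) *
    gauss g (y + j.1%:~R * ((q * u - p * v)%:~R / sigma) + j.2%:~R * sigma -
             t.2%:~R * (c / sigma)).
  apply: (@stable_sampling_swap _ (fun x y (j t : int * int) =>
    gauss g (x + (- q * j.1 + p * j.2)%:~R / sigma - t.2%:~R * (d * sigma)) *
    gauss g (y + (p * j.1 + q * j.2)%:~R / sigma - t.1%:~R * (c / sigma)))).
    by move=> x y j t; rewrite mulrC.
  apply: (@stable_sampling_reindex _ K _
    (fun j => (- q * j.1 + p * j.2, u * j.1 + v * j.2))
    (fun n => (- v * n.1 + p * n.2, u * n.1 + q * n.2))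
    (fun t => (t.2, t.1)) (fun t => (t.2, t.1))) => //.
  + move=> [j1 j2] /=; congr pair.
      by rewrite -[RHS]mul1r -uv; ring.
    by rewrite -[RHS]mul1r -uv; ring.
  + by move=> [].
  + by move=> [].
  + move=> x y [j1 j2] [t1 t2]; rewrite /K /=; congr (gauss g _ * gauss g _).
    congr (_ - _); rewrite -addrA; congr (_ + _).
    have E : p * j1 + q * j2 = (- q * j1 + p * j2) * (q * u - p * v) +
        (u * j1 + v * j2) * (p ^+ 2 + q ^+ 2).
      by rewrite -[LHS]mul1r -uv; ring.
    have E' : (p * j1 + q * j2)%:~R =
        (- q * j1 + p * j2)%:~R * (q * u - p * v)%:~R + (u * j1 + v * j2)%:~R * sigma ^+ 2 :> R.
      rewrite [in LHS]E sgE; move: (- q * j1 + p * j2) (q * u - p * v) (u * j1 + v * j2) => e1 e2 e3.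
      by rewrite intrD !intrM intrD !rmorphXn.
    by rewrite E'; field; rewrite gt_eqF.
  + apply: stable_sampling_sheared => //; apply/andP; split=> //.
      by rewrite -ltr_pdivlMr// -expr2 exprVn.
    by rewrite ltr_pdivrMr// -expr2.
Qed.

(** * Bounded functions with bounded support *)

(** Functions of this kind are integrable with all their products, slices and
    partial integrals; [N] is a gauge whose sublevel sets have finite measure. *)
Section tame.
Context d (T : measurableType d) (R : realType) (mu : {measure set T -> \bar R}).
Variable N : T -> R.
Hypothesis mN : measurable_fun setT N.
Hypothesis finN : forall M, (mu [set x | (N x <= M)%R] < +oo)%E.

Definition tame (f : T -> R) := measurable_fun setT f /\
  exists M, forall x, `|f x| <= M /\ (M < N x -> f x = 0).

Definition bounded_meas (f : T -> R) := measurable_fun setT f /\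
  exists M, forall x, `|f x| <= M.

Lemma eq_tame g f : tame g -> (forall x, f x = g x) -> tame f.
Proof. by move=> tg /funext ->. Qed.

Lemma tame_bounded f : tame f -> bounded_meas f.
Proof. by move=> [mf [M fM]]; split=> //; exists M => x; case: (fM x). Qed.

Lemma tame0 : tame (fun=> 0).
Proof.
by split; [exact: measurable_cst|exists 0 => x; rewrite normr0].
Qed.

Lemma tameD f g : tame f -> tame g -> tame (fun x => f x + g x).
Proof.
move=> [mf [M fM]] [mg [L gL]]; split; first exact: measurable_funD.
exists (Num.max (M + L) (Num.max M L)) => x.
have [f1 f2] := fM x; have [g1 g2] := gL x; split.
  rewrite le_max; apply/orP; left.
  by rewrite (le_trans (ler_normD _ _))// lerD.
by rewrite !gt_max => /andP[_ /andP[/f2-> /g2->]]; rewrite addr0.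
Qed.

Lemma tameM f g : tame f -> bounded_meas g -> tame (fun x => f x * g x).
Proof.
move=> [mf [M fM]] [mg [L gL]]; split; first exact: measurable_funM.
exists (Num.max (M * L) M) => x; have [f1 f2] := fM x; split.
  by rewrite le_max normrM ler_pM.
by rewrite gt_max => /andP[_ /f2->]; rewrite mul0r.
Qed.

Lemma bounded_meas_cst k : bounded_meas (fun=> k).
Proof. by split; [exact: measurable_cst|exists `|k|]. Qed.

Lemma bounded_measM f g : bounded_meas f -> bounded_meas g ->
  bounded_meas (fun x => f x * g x).
Proof.
move=> [mf [M fM]] [mg [L gL]]; split; first exact: measurable_funM.
by exists (M * L) => x; rewrite normrM ler_pM.
Qed.

Lemma bounded_measD f g : bounded_meas f -> bounded_meas g ->
  bounded_meas (fun x => f x + g x).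
Proof.
move=> [mf [M fM]] [mg [L gL]]; split; first exact: measurable_funD.
by exists (M + L) => x; rewrite (le_trans (ler_normD _ _))// lerD.
Qed.

Lemma tameZ k f : tame f -> tame (fun x => k * f x).
Proof.
move=> tf; apply: eq_tame (tameM tf (bounded_meas_cst k)) _ => x.
by rewrite mulrC.
Qed.

Lemma tame_sum (I : Type) (s : seq I) (P : pred I) (f : I -> T -> R) :
  (forall i, tame (f i)) -> tame (fun x => \sum_(i <- s | P i) f i x).
Proof.
move=> tf; elim: s => [|a s IH].
  by apply: eq_tame tame0 _ => x; rewrite big_nil.
apply: (@eq_tame (fun x => (if P a then f a x else 0) + \sum_(i <- s | P i) f i x)).
  by case: (P a); apply: tameD => //; exact: tame0.
by move=> x; rewrite big_cons; case: ifP; rewrite ?add0r.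
Qed.

Lemma tame_integrable f : tame f -> mu.-integrable setT (EFin \o f).
Proof.
move=> [mf [M fM]]; pose A := [set x | N x <= M].
have mA : measurable A.
  rewrite -[A]setTI (_ : A = N @^-1` `]-oo, M]); last first.
    by apply/seteqP; split => x; rewrite /A/= in_itv.
  exact: mN.
rewrite (_ : EFin \o f = (EFin \o f) \_ A).
  apply: (integrable_mkcond (EFin \o f) mA).1.
  apply: measurable_bounded_integrable => //.
  - exact: finN.
  - exact: measurable_funTS.
  - exists M; split; first exact: num_real.
    by move=> K MK x _ /=; case: (fM x) => /le_trans + _; apply; exact: ltW.
apply/funext => x; rewrite patchE; case: ifPn => // /negP xA /=.
have [_ ->//] := fM x; rewrite ltNge; apply/negP => Nx; apply: xA.
by rewrite inE.
Qed.

Local Notation I := (Rintegral mu setT).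

Lemma tame_intD f g : tame f -> tame g -> I (fun x => f x + g x) = I f + I g.
Proof. by move=> /tame_integrable ? /tame_integrable ?; rewrite RintegralD. Qed.

Lemma tame_intZ k f : tame f -> I (fun x => k * f x) = k * I f.
Proof. by move=> /tame_integrable ?; rewrite RintegralZl. Qed.

Lemma tame_int0 : I (fun=> 0) = 0.
Proof. by rewrite Rintegral_cst// mul0r. Qed.

Lemma tame_int_sum (J : Type) (s : seq J) (f : J -> T -> R) :
  (forall i, tame (f i)) ->
  I (fun x => \sum_(i <- s) f i x) = \sum_(i <- s) I (f i).
Proof.
move=> tf; elim: s => [|a s IH].
  rewrite big_nil -[RHS]tame_int0; congr Rintegral.
  by apply/funext => x; rewrite big_nil.
rewrite big_cons -IH -tame_intD//; last exact: tame_sum.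
by congr Rintegral; apply/funext => x; rewrite big_cons.
Qed.

Lemma tame_int_ge0 f : (forall x, 0 <= f x) -> 0 <= I f.
Proof. by move=> f0; apply: Rintegral_ge0 => x _; exact: f0. Qed.

Lemma tame_int_le f g : tame f -> tame g -> (forall x, f x <= g x) -> I f <= I g.
Proof.
by move=> /tame_integrable ? /tame_integrable ? fg; apply: le_Rintegral.
Qed.

End tame.

Section tame_line_plane.
Context (R : realType).
Local Notation mu := (@lebesgue_measure R).

Definition gauge2 (z : R * R) : R := Num.max `|z.1| `|z.2|.
Definition tame1 : (R -> R) -> Prop := tame (fun x : R => `|x|).
Definition tame2 : (R * R -> R) -> Prop := tame gauge2.
Definition int1 (f : R -> R) : R := Rintegral mu setT f.
Definition int2 (f : R * R -> R) : R := Rintegral (lebesgue2 R) setT f.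

Lemma norm_measurable : measurable_fun setT (fun x : R => `|x|).
Proof. exact: measurableT_comp. Qed.

Lemma gauge2_measurable : measurable_fun setT gauge2.
Proof.
by apply: measurable_maxr; apply: measurableT_comp.
Qed.

Lemma norm_sublevel_fin (M : R) : (mu [set x : R | (`|x| <= M)%R] < +oo)%E.
Proof.
rewrite (_ : [set x | _] = `[- M, M]%classic); last first.
  by apply/seteqP; split => x /=; rewrite in_itv/= ler_norml.
by rewrite lebesgue_measure_itv/=; case: ifP => // _; rewrite -EFinD ltry.
Qed.

Lemma gauge2_sublevel_fin (M : R) : (lebesgue2 R [set x | (gauge2 x <= M)%R] < +oo)%E.
Proof.
rewrite (_ : [set x | _] = `[- M, M]%classic `*` `[- M, M]%classic); last first.
  by apply/seteqP; split => -[x y] /=; rewrite /gauge2 /= ge_max !in_itv/= -!ler_norml => /andP.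
rewrite [X in (X < _)%E](_ : _ = mu `[(- M)%R, M]%classic * mu `[(- M)%R, M]%classic)%E; last first.
  exact: product_measure1E.
rewrite lebesgue_measure_itv/=; case: ifP => // _; last by rewrite mul0e.
by rewrite -EFinD -EFinM ltry.
Qed.

Lemma tame1_integrable f : tame1 f -> mu.-integrable setT (EFin \o f).
Proof. by move=> *; apply: tame_integrable; first [exact: norm_measurable|exact: norm_sublevel_fin|assumption]. Qed.

Lemma int1Z k f : tame1 f -> int1 (fun x => k * f x) = k * int1 f.
Proof. by move=> *; apply: tame_intZ; first [exact: norm_measurable|exact: norm_sublevel_fin|assumption]. Qed.

Lemma int1_sum (J : Type) (s : seq J) (f : J -> R -> R) : (forall i, tame1 (f i)) ->
  int1 (fun x => \sum_(i <- s) f i x) = \sum_(i <- s) int1 (f i).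
Proof. by move=> *; apply: tame_int_sum; first [exact: norm_measurable|exact: norm_sublevel_fin|assumption]. Qed.

Lemma int1_le f g : tame1 f -> tame1 g -> (forall x, f x <= g x) -> int1 f <= int1 g.
Proof. by move=> *; apply: tame_int_le; first [exact: norm_measurable|exact: norm_sublevel_fin|assumption]. Qed.

Lemma tame2_integrable f : tame2 f -> (lebesgue2 R).-integrable setT (EFin \o f).
Proof. by move=> *; apply: tame_integrable; first [exact: gauge2_measurable|exact: gauge2_sublevel_fin|assumption]. Qed.

Lemma int2D f g : tame2 f -> tame2 g -> int2 (fun x => f x + g x) = int2 f + int2 g.
Proof. by move=> *; apply: tame_intD; first [exact: gauge2_measurable|exact: gauge2_sublevel_fin|assumption]. Qed.

Lemma int2Z k f : tame2 f -> int2 (fun x => k * f x) = k * int2 f.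
Proof. by move=> *; apply: tame_intZ; first [exact: gauge2_measurable|exact: gauge2_sublevel_fin|assumption]. Qed.

Lemma int2_sum (J : Type) (s : seq J) (f : J -> R * R -> R) : (forall i, tame2 (f i)) ->
  int2 (fun x => \sum_(i <- s) f i x) = \sum_(i <- s) int2 (f i).
Proof. by move=> *; apply: tame_int_sum; first [exact: gauge2_measurable|exact: gauge2_sublevel_fin|assumption]. Qed.

Lemma int2_le f g : tame2 f -> tame2 g -> (forall x, f x <= g x) -> int2 f <= int2 g.
Proof. by move=> *; apply: tame_int_le; first [exact: gauge2_measurable|exact: gauge2_sublevel_fin|assumption]. Qed.

Lemma tame1_slice f x : tame2 f -> tame1 (fun y => f (x, y)).
Proof.
move=> [mf [M fM]]; split; first exact: measurableT_comp.
exists M => y; have [f1 f2] := fM (x, y); split => // My; apply: f2.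
by rewrite /gauge2 lt_max My orbT.
Qed.

Lemma int2E f : tame2 f -> int2 f = int1 (fun x => int1 (fun y => f (x, y))).
Proof.
move=> tf; rewrite /int2 /int1 /Rintegral /lebesgue2.
rewrite -integral12_prod_meas1; last exact: tame2_integrable.
congr fine; apply: eq_integral => x _; rewrite fineK//.
by apply: integrable_fin_num => //; apply: tame1_integrable; exact: tame1_slice.
Qed.

Lemma tame1_int f : tame2 f -> tame1 (fun x => int1 (fun y => f (x, y))).
Proof.
move=> tf; have tf' := tf; move: tf => [mf [M fM]]; split.
  have := measurable_fubini_F (tame2_integrable tf').
  move=> h; apply/measurable_EFinP; apply: eq_measurable_fun h => x _.
  rewrite /fubini_F /int1 /Rintegral/= fineK//.
  by apply: integrable_fin_num => //; apply: tame1_integrable; exact: tame1_slice.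
have M0 : 0 <= M by have [/(le_trans _)-> //] := fM (0, 0).
pose A : set R := `[- M, M]%classic.
have mA : measurable A by exact: measurable_itv.
have tA : tame1 (\1_A : R -> R).
  split; first exact: measurable_indic.
  exists (Num.max 1 M) => x; split.
    by rewrite le_max indicE; case: (_ \in _); rewrite ?normr1 ?normr0 ?lexx ?ler01.
  rewrite gt_max => /andP[_ Mx]; rewrite indicE memNset// /A/= in_itv/= -ler_norml.
  by apply/negP; rewrite -ltNge.
exists (Num.max (M * int1 \1_A) M) => x; split; last first.
  rewrite gt_max => /andP[_ Mx].
  rewrite (_ : (fun y => _) = fun=> 0); first exact: tame_int0.
  by apply/funext => y; have [_ ->//] := fM (x, y); rewrite /gauge2 lt_max Mx.
rewrite le_max; apply/orP; left.
rewrite -int1Z//.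
apply: le_trans (le_normr_Rintegral measurableT (tame1_integrable (tame1_slice x tf'))) _.
apply: int1_le.
- have [ms [K sK]] := tame1_slice x tf'; split; first exact: measurableT_comp.
  by exists K => y; have [s1 s2] := sK y; rewrite normr_id; split => // /s2 ->; rewrite normr0.
- exact: tameZ.
move=> y; have [f1 f2] := fM (x, y); rewrite indicE.
case: (boolP (y \in A)) => yA; first by rewrite mulr1.
rewrite mulr0 f2 ?normr0// /gauge2 lt_max; apply/orP; right; rewrite ltNge.
by apply/negP => yM; move/negP: yA; apply; rewrite inE/A/= in_itv/= -ler_norml.
Qed.

End tame_line_plane.

Section translation.
Context (R : realType).
Local Notation mu := (@lebesgue_measure R).

Definition translate (h : R) (x : measurableTypeR R) : measurableTypeR R := x + h.

Lemma translate_measurable h : measurable_fun setT (translate h).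
Proof. exact: measurable_funD. Qed.

Lemma lebesgue_translate h (A : set (measurableTypeR R)) : measurable A ->
  mu A = pushforward mu (translate h) A.
Proof.
move: A; apply: lebesgue_measure_unique => [|mt X [[a b] /= ab <-]].
  exact: translate_measurable.
rewrite /pushforward (_ : _ @^-1` _ = `]a - h, b - h]%classic).
  rewrite !lebesgue_measure_itv/= !lte_fin ltrD2r.
  by case: ifP => // _; rewrite -!EFinD opprD opprK addrA addrAC subrK.
by apply/seteqP; split => x; rewrite /translate /= !in_itv/= ltrBlDr lerBrDr.
Qed.

Lemma tame1_translate f h : tame1 f -> tame1 (fun x : R => f (x + h)).
Proof.
move=> [mf [M fM]]; split.
  by apply: (measurableT_comp mf); exact: translate_measurable.
exists (M + `|h|) => x; have [f1 f2] := fM (x + h); split.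
  by rewrite (le_trans f1)// lerDl.
move=> Mx; apply: f2; have := ler_normB (x + h) h; rewrite addrK; lra.
Qed.

Lemma int1_translate f h : tame1 f -> int1 (fun x : R => f (x + h)) = int1 f.
Proof.
move=> tf; have tf' := tame1_translate h tf; rewrite /int1 /Rintegral; congr fine.
have mt := translate_measurable h.
have mf : measurable_fun setT (EFin \o f) by apply/measurable_EFinP; case: tf.
have E := @integral_pushforward _ _ _ _ _ _ mt mu setT _ mf.
rewrite preimage_setT in E; rewrite -[LHS](E (tame1_integrable tf') measurableT).
apply: eq_measure_integral => A mA _; apply/esym; exact: lebesgue_translate.
Qed.

Lemma tame2_translate f h k : tame2 f -> tame2 (fun z : R * R => f (z.1 + h, z.2 + k)).
Proof.
move=> [mf [M fM]]; split.
  apply: (measurableT_comp mf); apply: measurable_fun_pair.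
    by apply: measurable_funD => //; exact: measurable_fst.
  by apply: measurable_funD => //; exact: measurable_snd.
exists (M + `|h| + `|k|) => z; have [f1 f2] := fM (z.1 + h, z.2 + k); split.
  by rewrite (le_trans f1)// -addrA lerDl addr_ge0.
move=> Mx; apply: f2; rewrite /gauge2 /=.
have := ler_normB (z.1 + h) h; have := ler_normB (z.2 + k) k; rewrite !addrK.
have := normr_ge0 h; have := normr_ge0 k.
move: Mx; rewrite /gauge2 !lt_max => /orP[] *; apply/orP; [left|right]; lra.
Qed.

Lemma int2_translate f h k : tame2 f -> int2 (fun z : R * R => f (z.1 + h, z.2 + k)) = int2 f.
Proof.
move=> tf; rewrite int2E; last exact: tame2_translate.
transitivity (int1 (fun x : R => int1 (fun y : R => f (x + h, y)))).
  congr int1; apply/funext => x.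
  exact: (int1_translate k (tame1_slice (x + h) tf)).
rewrite [RHS](int2E tf).
exact: (int1_translate (f := fun x : R => int1 (fun y : R => f (x, y))) h (tame1_int tf)).
Qed.

Lemma bounded_meas_fst (f : R -> R) : bounded_meas f -> bounded_meas (fun z : R * R => f z.1).
Proof.
move=> [mf [M fM]]; split; last by exists M.
by apply: (measurableT_comp mf); exact: measurable_fst.
Qed.

Lemma bounded_meas_snd (f : R -> R) : bounded_meas f -> bounded_meas (fun z : R * R => f z.2).
Proof.
move=> [mf [M fM]]; split; last by exists M.
by apply: (measurableT_comp mf); exact: measurable_snd.
Qed.

Lemma tame2_tensor (f g : R -> R) : tame1 f -> tame1 g -> tame2 (fun z : R * R => f z.1 * g z.2).
Proof.
move=> tf tg.
have [[mf [M fM]] [mg [L gL]]] := (tf, tg).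
split.
  apply: measurable_funM; first by apply: (measurableT_comp mf); exact: measurable_fst.
  by apply: (measurableT_comp mg); exact: measurable_snd.
exists (Num.max (M * L) (Num.max M L)) => z.
have [f1 f2] := fM z.1; have [g1 g2] := gL z.2; split.
  by rewrite le_max normrM ler_pM.
rewrite !gt_max /gauge2 => /and3P[_].
by case: (leP `|z.1| `|z.2|) => _ Mz Lz; [rewrite g2// mulr0|rewrite f2// mul0r].
Qed.

End translation.

(** * Fourier series of bounded functions *)

Section fejer.
Context (R : realType).
Variable a : R.
Hypothesis a0 : 0 < a.

Definition wave (b : bool) (om x : R) : R :=
  if b then sin (2 * pi * om * x) else cos (2 * pi * om * x).

Lemma cos_2pi_int (k : int) : cos (2 * pi * k%:~R) = 1 :> R.
Proof.
have E (n : nat) : cos (2 * pi * n%:R) = 1 :> R.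
  have -> : 2 * pi * n%:R = 0 + (pi *+ 2) *+ n :> R.
    by rewrite add0r -[RHS]mulr_natr -[pi *+ 2]mulr_natl.
  by rewrite (periodicn (@cosD2pi R)) cos0.
by case: k => n; rewrite ?NegzE ?mulrNz ?mulrN ?cosN; exact: E.
Qed.

Lemma sin_2pi_int (k : int) : sin (2 * pi * k%:~R) = 0 :> R.
Proof.
have E (n : nat) : sin (2 * pi * n%:R) = 0 :> R.
  have -> : 2 * pi * n%:R = 0 + (pi *+ 2) *+ n :> R.
    by rewrite add0r -[RHS]mulr_natr -[pi *+ 2]mulr_natl.
  by rewrite (periodicn (@sinD2pi R)) sin0.
case: k => n; rewrite ?NegzE ?mulrNz ?mulrN ?sinN; first exact: E.
by rewrite -[_%:~R]/(_%:R) E oppr0.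
Qed.

Definition cell (x : R) : R := \1_(`[0, a^-1[%classic : set R) x.

Lemma wave_continuous b om : continuous (wave b om).
Proof.
move=> x; rewrite /wave; case: b.
  by apply: continuous_comp; [exact: mulrl_continuous|exact: continuous_sin].
by apply: continuous_comp; [exact: mulrl_continuous|exact: continuous_cos].
Qed.

Lemma wave_bounded b om : bounded_meas (wave b om).
Proof.
split.
  by apply: continuous_measurable_fun => x; exact: wave_continuous.
exists 1 => x; rewrite /wave; case: b.
  by rewrite ler_norml sin_geN1 sin_le1.
by rewrite ler_norml cos_geN1 cos_le1.
Qed.

Lemma cell_tame : tame1 cell.
Proof.
split; first exact: measurable_indic.
exists (1 + a^-1) => x; rewrite /cell indicE; split.
  case: (_ \in _); rewrite ?normr1 ?normr0 ?lerDl ?addr_ge0 ?invr_ge0 ?(ltW a0)//.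
move=> ax; rewrite memNset//= in_itv/= => /andP[x0].
by move: ax; rewrite ger0_norm//; lra.
Qed.

Lemma cell_range x : cell x = 0 \/ cell x = 1 /\ 0 <= x < a^-1.
Proof.
rewrite /cell indicE; case: (boolP (_ \in _)) => h; [right|left] => //.
by split => //; move: h; rewrite inE/= in_itv.
Qed.

Lemma cell_ge0 x : 0 <= cell x.
Proof. by case: (cell_range x) => [->|[-> _]]. Qed.

Lemma cell_idem x : cell x * cell x = cell x.
Proof. by case: (cell_range x) => [->|[-> _]]; rewrite ?mulr0 ?mulr1. Qed.

Lemma int1_cell_wave b (k : int) :
  int1 (fun x => cell x * wave b (a * k%:~R) x) = a^-1 * ((k == 0) && ~~ b)%:R.
Proof.
have E : int1 (fun x => cell x * wave b (a * k%:~R) x) =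
    fine (\int[lebesgue_measure]_(x in `[0, a^-1]%classic) (wave b (a * k%:~R) x)%:E).
  rewrite -integral_itv_bndo_bndc; last first.
    apply/measurable_EFinP; apply: measurable_funTS.
    by case: (wave_bounded b (a * k%:~R)).
  rewrite /int1 /Rintegral; congr fine; rewrite [RHS]integral_mkcond.
  apply: eq_integral => x _; rewrite patchE /cell indicE.
  by case: (_ \in _); rewrite ?mul1r ?mul0r.
rewrite {}E; have ai0 : 0 < a^-1 by rewrite invr_gt0.
have [->|k0] := eqVneq k 0.
  have -> : (fun x => (wave b (a * 0%:~R) x)%:E) = cst (if b then 0 else 1)%:E.
    by apply/funext => x; rewrite /wave mulr0z !mulr0 mul0r sin0 cos0; case: b.
  rewrite integral_cst//= lebesgue_measure_itv/= lte_fin ai0 oppr0 adde0.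
  by case: b; rewrite /= ?mul0r ?mulr0 ?mul1r ?mulr1.
pose w := 2 * pi * (a * k%:~R) : R.
have w0 : w != 0.
  by rewrite /w !mulf_neq0 ?intr_eq0// ?(gt_eqF a0)// gt_eqF// pi_gt0.
pose F x := if b then - cos (w * x) / w else sin (w * x) / w.
have dF x : is_derive x (1 : R) F (wave b (a * k%:~R) x).
  rewrite /F /wave -/w; case: (b).
    by apply: is_derive_eq; rewrite /GRing.scale/=; field.
  by apply: is_derive_eq; rewrite /GRing.scale/=; field.
have cF x : {for x, continuous F}.
  by apply/differentiable_continuous/derivable1_diffP; case: (dF x).
rewrite (@continuous_FTC2 _ _ F)//.
- have wT : w * a^-1 = 2 * pi * k%:~R by rewrite /w; field; rewrite gt_eqF.
  rewrite /F wT !mulr0 sin0 cos0 cos_2pi_int sin_2pi_int.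
  by case: (b) => /=; rewrite ?subrr ?mul0r ?subrr.
- by apply: continuous_subspaceT => x; exact: wave_continuous.
- split.
  + by move=> x _; case: (dF x).
  + by apply: cvg_at_right_filter; exact: cF.
  + by apply: cvg_at_left_filter; exact: cF.
- by move=> x _; rewrite derive1E; case: (dF x).
Qed.

End fejer.

Section fejer_kernel.
Context (R : realType).
Variable a : R.
Hypothesis a0 : 0 < a.

Definition coef (b : bool) (k : int) (v : R -> R) : R :=
  int1 (fun x => v x * wave b (a * k%:~R) x).

(** For a real [v], the squared modulus of the complex Fourier coefficient. *)
Definition power (v : R -> R) (k : int) : R := coef false k v ^+ 2 + coef true k v ^+ 2.

Lemma power_ge0 v k : 0 <= power v k.
Proof. by rewrite addr_ge0 ?sqr_ge0. Qed.

(** The squared modulus of a geometric sum, that is [N] times the Fejer kernel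
    of period [a^-1]; here [N] is only a factor, and omitting the division keeps
    the expansion [fejerE] free of quotients. *)
Definition fejer (N : nat) (t : R) : R :=
  (\sum_(j < N) wave false (a * j%:R) t) ^+ 2 + (\sum_(j < N) wave true (a * j%:R) t) ^+ 2.

Lemma fejer_ge0 N t : 0 <= fejer N t.
Proof. by rewrite addr_ge0 ?sqr_ge0. Qed.

Lemma fejerE N x y : fejer N (x - y) =
  \sum_(j < N) \sum_(k < N) \sum_(b <- [:: false; true])
    wave b (a * (j%:Z - k%:Z)%:~R) x * wave b (a * (j%:Z - k%:Z)%:~R) y.
Proof.
rewrite /fejer !expr2 !mulr_suml -big_split/=; apply: eq_bigr => j _.
rewrite !mulr_sumr -big_split/=; apply: eq_bigr => k _.
rewrite big_cons big_seq1 /wave -cosB -cosB; congr cos.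
by rewrite intrD mulrNz -!pmulrn; ring.
Qed.

Lemma bounded_meas_fejer N : bounded_meas (fun z : R * R => fejer N (z.1 - z.2)).
Proof.
have bs (J : Type) (s : seq J) (f : J -> R * R -> R) :
    (forall i, bounded_meas (f i)) -> bounded_meas (fun z => \sum_(i <- s) f i z).
  move=> bf; elim: s => [|i s IH].
    rewrite (_ : (fun z => _) = fun=> 0); first exact: bounded_meas_cst.
    by apply/funext => z; rewrite big_nil.
  rewrite (_ : (fun z => _) = fun z => f i z + \sum_(j <- s) f j z).
    exact: bounded_measD.
  by apply/funext => z; rewrite big_cons.
rewrite (_ : (fun z => _) = fun z : R * R => \sum_(j < N) \sum_(k < N) \sum_(b <- [:: false; true])
    wave b (a * (j%:Z - k%:Z)%:~R) z.1 * wave b (a * (j%:Z - k%:Z)%:~R) z.2).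
  do 3 (apply: (bs) => ?); apply: bounded_measM.
    by apply: (bounded_meas_fst (wave_bounded _ _)).
  by apply: (bounded_meas_snd (wave_bounded _ _)).
by apply/funext => z; exact: fejerE.
Qed.

Lemma int2_tensor (f g : R -> R) : tame1 f -> tame1 g ->
  int2 (fun z : R * R => f z.1 * g z.2) = int1 f * int1 g.
Proof.
move=> tf tg; rewrite int2E; last exact: tame2_tensor.
rewrite mulrC -int1Z//; congr int1; apply/funext => x /=.
by rewrite mulrC -int1Z.
Qed.

Lemma int2_fejer (f g : R -> R) N : tame1 f -> tame1 g ->
  int2 (fun z : R * R => f z.1 * g z.2 * fejer N (z.1 - z.2)) =
  \sum_(j < N) \sum_(k < N) \sum_(b <- [:: false; true])
    coef b (j%:Z - k%:Z) f * coef b (j%:Z - k%:Z) g.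
Proof.
move=> tf tg.
pose F b (j k : 'I_N) (z : R * R) := (f z.1 * wave b (a * (j%:Z - k%:Z)%:~R) z.1) *
   (g z.2 * wave b (a * (j%:Z - k%:Z)%:~R) z.2).
have tF b j k : tame2 (F b j k).
  exact: tame2_tensor (tameM tf (wave_bounded _ _)) (tameM tg (wave_bounded _ _)).
rewrite (_ : (fun z => _) = fun z => \sum_(j < N) \sum_(k < N) \sum_(b <- [:: false; true]) F b j k z).
  rewrite int2_sum; last by move=> j; apply: tame_sum => k; apply: tame_sum => b; exact: tF.
  apply: eq_bigr => j _; rewrite int2_sum; last by move=> k; apply: tame_sum => b; exact: tF.
  apply: eq_bigr => k _; rewrite int2_sum//; apply: eq_bigr => b _.
  exact: int2_tensor (tameM tf (wave_bounded _ _)) (tameM tg (wave_bounded _ _)).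
apply/funext => z; rewrite fejerE mulr_sumr; apply: eq_bigr => j _.
rewrite mulr_sumr; apply: eq_bigr => k _; rewrite mulr_sumr; apply: eq_bigr => b _.
by rewrite /F mulrACA.
Qed.

(** Against the constant function only the terms with [j = k] survive. *)
Lemma sum_coef_cell f N : tame1 f ->
  \sum_(j < N) \sum_(k < N) \sum_(b <- [:: false; true])
    coef b (j%:Z - k%:Z) f * coef b (j%:Z - k%:Z) (cell a) = N%:R * a^-1 * int1 f.
Proof.
move=> tf.
have E (j : 'I_N) : \sum_(k < N) \sum_(b <- [:: false; true])
    coef b (j%:Z - k%:Z) f * coef b (j%:Z - k%:Z) (cell a) = a^-1 * int1 f.
  rewrite (bigD1 j)//= [X in _ + X]big1 ?addr0 => [|k kj].
    rewrite big_cons big_seq1 /coef !int1_cell_wave// !subrr eqxx/= !mulr0 addr0 mulr1.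
    rewrite mulrC; congr (_ * int1 _); apply/funext => x.
    by rewrite /wave /= !(mulr0, mul0r) cos0 mulr1.
  rewrite big_cons big_seq1 /coef !int1_cell_wave//.
  have -> : (j%:Z - k%:Z == 0) = false.
    by apply/negbTE; rewrite subr_eq0; apply: contra kj => /eqP[/val_inj ->].
  by rewrite /= !mulr0 addr0.
under eq_bigr do rewrite E.
by rewrite sumr_const card_ord -[LHS]mulr_natl mulrA.
Qed.

Definition supported (v : R -> R) := forall x, v x = v x * cell a x.

(** Expanding [(v x - v y) ^+ 2] gives, up to normalization, twice the integral of
    [v ^+ 2] minus twice a Cesaro sum of the power spectrum of [v].  The left-hand side is nonnegative,
    whence Bessel's inequality, and small because the kernel concentrates on
    the diagonal, whence the converse. *)
Lemma fejer_defect v N : tame1 v -> supported v ->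
  int2 (fun z : R * R => cell a z.1 * cell a z.2 * (v z.1 - v z.2) ^+ 2 * fejer N (z.1 - z.2)) =
  2 * (N%:R * a^-1 * int1 (fun x => v x ^+ 2) -
       \sum_(j < N) \sum_(k < N) power v (j%:Z - k%:Z)).
Proof.
move=> tv sv.
have tv2 : tame1 (fun x => v x ^+ 2).
  by apply: eq_tame (tameM tv (tame_bounded tv)) _ => x; rewrite expr2.
have tc := cell_tame a0.
have tt (f g : R -> R) : tame1 f -> tame1 g ->
    tame2 (fun z : R * R => f z.1 * g z.2 * fejer N (z.1 - z.2)).
  by move=> tf tg; apply: tameM (tame2_tensor tf tg) (bounded_meas_fejer N).
rewrite (_ : (fun z => _) = fun z : R * R =>
   (v z.1 ^+ 2 * cell a z.2 * fejer N (z.1 - z.2) +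
    cell a z.1 * v z.2 ^+ 2 * fejer N (z.1 - z.2)) +
   (-2) * (v z.1 * v z.2 * fejer N (z.1 - z.2))); last first.
  apply/funext => z; rewrite (sv z.1) (sv z.2).
  by case: (cell_range a z.1) => [->|[-> _]]; case: (cell_range a z.2) => [->|[-> _]]; ring.
have [h1 h2 h3] := And3 (tt _ _ tv2 tc) (tt _ _ tc tv2) (tt _ _ tv tv).
rewrite int2D; [|exact: tameD h1 h2|exact: tameZ h3].
rewrite (int2D h1 h2) (int2Z _ h3).
rewrite (int2_fejer _ tv2 tc) (int2_fejer _ tc tv2) (int2_fejer _ tv tv).
rewrite (sum_coef_cell _ tv2).
rewrite [X in _ + X + _](_ : _ = N%:R * a^-1 * int1 (fun x => v x ^+ 2)); last first.
  rewrite -(sum_coef_cell _ tv2); do 3 (apply: eq_bigr => ? _).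
  by rewrite mulrC.
rewrite [X in -2 * X](_ : _ = \sum_(j < N) \sum_(k < N) power v (j%:Z - k%:Z)).
  by ring.
by do 2 (apply: eq_bigr => ? _); rewrite big_cons big_seq1 /power !expr2.
Qed.

Lemma bessel v L : tame1 v -> supported v ->
  \sum_(m <- zrange L) power v m <= 2 * a^-1 * int1 (fun x => v x ^+ 2).
Proof.
move=> tv sv; pose N := (4 * L + 2)%N.
have : 0 <= 2 * (N%:R * a^-1 * int1 (fun x => v x ^+ 2) -
       \sum_(j < N) \sum_(k < N) power v (j%:Z - k%:Z)).
  rewrite -fejer_defect//; apply: tame_int_ge0 => z.
  apply: mulr_ge0 (fejer_ge0 _ _); apply: mulr_ge0 (sqr_ge0 _).
  by apply: mulr_ge0; exact: cell_ge0.
(* With [N = 4 L + 2], each [m] with [`|m| <= L] is a difference [j - k] for all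
   the [2 L + 1 = N / 2] values of [j] between [L] and [3 L]. *)
have : (2 * L + 1)%:R * \sum_(m <- zrange L) power v m <=
    \sum_(j < N) \sum_(k < N) power v (j%:Z - k%:Z).
  rewrite -(big_mkord predT (fun j => \sum_(k < N) power v (j%:Z - k%:Z))).
  apply: le_trans (ler_sum_sub (s := index_iota L (3 * L + 1)) _ _ _ _).
  - have -> : (2 * L + 1)%:R * \sum_(m <- zrange L) power v m =
        \sum_(L <= j < 3 * L + 1) \sum_(m <- zrange L) power v m.
      by rewrite sumr_const_nat -[RHS]mulr_natl; congr (_%:R * _); lia.
    rewrite big_seq [leRHS]big_seq; apply: ler_sum => j; rewrite mem_index_iota => jL.
    rewrite -(big_mkord predT (fun k => power v (j%:Z - k%:Z))).
    rewrite -(big_map (fun k : nat => j%:Z - k%:Z) predT (power v)).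
    apply: ler_sum_sub (zrange_uniq _) _ _ (power_ge0 v).
      by rewrite map_inj_uniq ?iota_uniq// => i k; lia.
    move=> m; rewrite mem_zrange => mL; apply/mapP.
    exists (absz (j%:Z - m)); last lia.
    rewrite mem_index_iota /N; lia.
  - exact: iota_uniq.
  - exact: iota_uniq.
  - move=> j; rewrite !mem_index_iota /N; lia.
  - by move=> j; apply: sumr_ge0 => k _; exact: power_ge0.
set S := \sum_(_ < _) _ => h1 h2.
have n0 : 0 < (2 * L + 1)%:R :> R by rewrite ltr0n addn1.
rewrite -(ler_pM2l n0); apply: le_trans h1 _.
have -> : (2 * L + 1)%:R = N%:R / 2 :> R.
  by rewrite natrD natrM /N natrD natrM; field.
lra.
Qed.

End fejer_kernel.

Section fejer_concentration.
Context (R : realType).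
Variable a : R.
Hypothesis a0 : 0 < a.

(** Multiplied by [2 * sin (pi * a * t)] the trigonometric sums telescope. *)
Lemma fejer_sin_le N (t : R) : fejer a N t * sin (pi * a * t) ^+ 2 <= 2.
Proof.
pose f := pi * a * t.
have waveE b (j : nat) : wave b (a * j%:R) t = if b then sin (2 * j%:R * f) else cos (2 * j%:R * f).
  rewrite /wave /f (_ : 2 * pi * (a * j%:R) * t = 2 * j%:R * (pi * a * t))//; ring.
have hc : 2 * sin f * \sum_(j < N) cos (2 * j%:R * f) = sin ((2 * N%:R - 1) * f) + sin f.
  elim: N => [|N IH].
    by rewrite big_ord0 !mulr0 sub0r mulN1r sinN addNr.
  rewrite big_ord_recr/= mulrDr IH.
  have -> : (2 * N.+1%:R - 1) * f = 2 * N%:R * f + f by rewrite -addn1 natrD; ring.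
  have -> : (2 * N%:R - 1) * f = 2 * N%:R * f - f by ring.
  by rewrite sinB sinD; ring.
have hs : 2 * sin f * \sum_(j < N) sin (2 * j%:R * f) = cos f - cos ((2 * N%:R - 1) * f).
  elim: N {hc} => [|N IH].
    by rewrite big_ord0 !mulr0 sub0r mulN1r cosN subrr.
  rewrite big_ord_recr/= mulrDr IH.
  have -> : (2 * N.+1%:R - 1) * f = 2 * N%:R * f + f by rewrite -addn1 natrD; ring.
  have -> : (2 * N%:R - 1) * f = 2 * N%:R * f - f by ring.
  by rewrite cosB cosD; ring.
rewrite /fejer; under eq_bigr do rewrite waveE.
under [X in (_ + X ^+ 2) * _]eq_bigr do rewrite waveE.
rewrite -/f; move: hc hs.
set C := \sum_(j < N) _; set S := \sum_(j < N) _ => hc hs.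
have h (u v : R) : `|u| <= 1 -> `|v| <= 1 -> (u + v) ^+ 2 <= 4.
  by rewrite !ler_norml => /andP[u1 u2] /andP[v1 v2]; nra.
have h1 : (2 * sin f * C) ^+ 2 <= 4.
  by rewrite hc; apply: h; rewrite ler_norml sin_geN1 sin_le1.
have h2 : (2 * sin f * S) ^+ 2 <= 4.
  rewrite hs; apply: h; first by rewrite ler_norml cos_geN1 cos_le1.
  by rewrite normrN ler_norml cos_geN1 cos_le1.
move: h1 h2; rewrite !exprMn; lra.
Qed.

Lemma sin_away_ge (e t : R) : 0 < e -> e < a^-1 / 2 ->
  e <= `|t| -> `|t| <= a^-1 - e ->
  0 < sin (pi * a * e) ^+ 2 <= sin (pi * a * t) ^+ 2.
Proof.
move=> e0 e1 et te.
have p0 : 0 < pi :> R := pi_gt0 R.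
have ha (x : R) : x <= a^-1 -> pi * a * x <= pi.
  by move=> xa; rewrite -mulrA ger_pMr// mulrC -ler_pdivlMr// mul1r.
have pa : 0 < pi * a by rewrite mulr_gt0.
apply/andP; split.
  apply: exprn_gt0; apply: sin_gt0_pi; rewrite mulr_gt0//=.
  have : pi * a * (e + e) <= pi by apply: ha; lra.
  by rewrite mulrDr; have := mulr_gt0 pa e0; lra.
have -> : sin (pi * a * t) ^+ 2 = sin (pi * a * `|t|) ^+ 2.
  by case: (ger0P t) => // _; rewrite mulrN sinN sqrrN.
rewrite -(lerD2l (cos (pi * a * e) ^+ 2)) cos2Dsin2.
rewrite -(cos2Dsin2 (pi * a * `|t|)) lerD2r -ler_sqrt ?sqr_ge0// !sqrtr_sqr.
have mem (x : R) : 0 <= x -> x <= a^-1 -> pi * a * x \in `[0, pi].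
  by move=> x0 xa; rewrite in_itv/= mulr_ge0 ?(ltW pa)//= ha.
have c1 : cos (pi * a * `|t|) <= cos (pi * a * e).
  rewrite leNgt ltr_cos; [|apply: mem; lra|apply: mem => //; lra].
  by rewrite ltr_pM2l// -leNgt.
have c2 : - cos (pi * a * e) <= cos (pi * a * `|t|).
  have -> : - cos (pi * a * e) = cos (pi * a * (a^-1 - e)).
    rewrite mulrBr mulfK ?gt_eqF// cosB cospi sinpi mul0r addr0; ring.
  rewrite leNgt ltr_cos; [|apply: mem => //; lra|apply: mem; lra].
  by rewrite ltr_pM2l// -leNgt.
have c0 : 0 <= cos (pi * a * e) by lra.
by rewrite (ger0_norm c0) ler_norml c2 c1.
Qed.

Lemma uniform_continuity_compact (K : set R) (v : R -> R) (e : R) :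
  compact K -> {within K, continuous v} -> 0 < e ->
  exists2 dl, 0 < dl & forall x y, K x -> K y -> `|x - y| < dl -> `|v x - v y| < e.
Proof.
move=> cK cv e0.
pose P (dl x : R) := K x -> forall y, K y -> `|x - y| < dl -> `|v x - v y| < e.
have H : \forall dl \near 0^'+, K `<=` P dl.
  apply: ((compact_near_coveringP K).1 cK R 0^'+ P _) => x Kx.
  have e20 : 0 < e / 2 by rewrite divr_gt0.
  have /cvgrPdist_lt /(_ _ e20) := (subspace_continuousP K v).1 cv x Kx.
  rewrite near_withinE => /nbhs_ballP[r /= r0 hr].
  exists (ball x (r / 2), [set dl | dl < r / 2]).
    split; first by apply: nbhsx_ballx; rewrite divr_gt0.
    by apply: nbhs_right_lt; rewrite divr_gt0.
  move=> [z dl] [] /=; rewrite /ball/= => xz dlr Kz y Ky zy.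
  have h w : `|x - w| < r -> K w -> `|v x - v w| < e / 2 by move=> xw Kw; exact: (hr w).
  have h1 := h z _ Kz; have h2 := h y _ Ky.
  have {}h1 : `|v x - v z| < e / 2 by apply: h1; lra.
  have {}h2 : `|v x - v y| < e / 2.
    apply: h2; have := ler_normD (x - z) (z - y).
    by rewrite addrA subrK; lra.
  have := ler_normD (v z - v x) (v x - v y); rewrite addrA subrK (distrC (v z) (v x)); lra.
near (0 : R)^'+ => dl.
exists dl; first by near: dl; exact: nbhs_right_gt.
have h : K `<=` P dl by near: dl.
by move=> x y Kx Ky; apply: (h x).
Unshelve. all: by end_near. Qed.

End fejer_concentration.

Section parseval.
Context (R : realType).
Variable a : R.
Hypothesis a0 : 0 < a.
Local Notation mu := (@lebesgue_measure R).

Lemma int1_indic (S : set R) : measurable S -> int1 (\1_S : R -> R) = fine (mu S).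
Proof. by move=> mS; rewrite /int1 /Rintegral integral_indic// setIT. Qed.

Lemma tame1_indic (S : set R) (M : R) : measurable S ->
  (forall x, S x -> `|x| <= M) -> tame1 (\1_S : R -> R).
Proof.
move=> mS SM; split; first exact: measurable_indic.
exists (Num.max 1 M) => x; rewrite indicE; split.
  by rewrite le_max; case: (_ \in _); rewrite ?normr1 ?normr0 ?lexx ?ler01.
rewrite gt_max => /andP[_ Mx]; rewrite memNset// => /SM.
by rewrite leNgt Mx.
Qed.

Lemma int1_cell : int1 (cell a) = a^-1.
Proof.
have := int1_cell_wave a0 false 0; rewrite eqxx /= mulr1 => <-; congr int1.
by apply/funext => x; rewrite /wave !(mulr0, mul0r) cos0 mulr1.
Qed.

Lemma int2_fejer_cellr f N : tame1 f ->
  int2 (fun z : R * R => f z.1 * cell a z.2 * fejer a N (z.1 - z.2)) =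
  N%:R * a^-1 * int1 f.
Proof. by move=> tf; rewrite (int2_fejer _ _ tf (cell_tame a0)) sum_coef_cell. Qed.

Lemma int2_fejer_celll f N : tame1 f ->
  int2 (fun z : R * R => cell a z.1 * f z.2 * fejer a N (z.1 - z.2)) =
  N%:R * a^-1 * int1 f.
Proof.
move=> tf; rewrite (int2_fejer _ _ (cell_tame a0) tf) -(sum_coef_cell a0 _ tf).
by do 3 (apply: eq_bigr => ? _); rewrite mulrC.
Qed.

(** By Lusin's theorem [v] is uniformly continuous on a compact set [K] that
    fills the period up to measure [e1].  The kernel lives near the diagonal and
    near the two opposite corners of the square; pairs with a point outside [K],
    or near the corners, contribute little because [v] is bounded. *)
Lemma parseval_lower (v : R -> R) (e : R) : tame1 v -> supported a v -> 0 < e ->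
  exists N, a^-1 * int1 (fun x => v x ^+ 2) - e <= \sum_(m <- zrange N) power a v m.
Proof.
move=> tv sv e0; set T := a^-1; have T0 : 0 < T by rewrite invr_gt0.
have [M0 M00 vM] : exists2 M0, 0 < M0 & forall x, `|v x| <= M0.
  move: tv => [_ [M hM]]; exists (`|M| + 1); first by rewrite ltr_pwDr.
  by move=> x; have [h _] := hM x; rewrite (le_trans h)// (le_trans (ler_norm M))// lerDl.
pose C := 4 * M0 ^+ 2; have C0 : 0 < C by rewrite mulr_gt0// exprn_gt0.
have CT0 : 0 < 4 * C * T by rewrite !mulr_gt0.
pose e1 := e / (4 * C * T); have e10 : 0 < e1 by rewrite divr_gt0.
pose e2 := e / (2 * T ^+ 2).
have e20 : 0 < e2 by rewrite divr_gt0// mulr_gt0// exprn_gt0.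
pose A : set R := `[0, T[%classic.
have mA : measurable A by exact: measurable_itv.
have finA : (mu A < +oo)%E.
  by rewrite lebesgue_measure_itv/= lte_fin T0 oppr0 adde0 ltry.
have mv : measurable_fun A v by apply: measurable_funTS; case: tv.
have [K [cK KA muK cv]] := measurable_almost_continuous mA finA e10 mv.
have se20 : 0 < Num.sqrt e2 by rewrite sqrtr_gt0.
have [dl0 dl00 hdl] := uniform_continuity_compact cK cv se20.
pose dl := Num.min dl0 (Num.min (T / 4) e1).
have dlP : 0 < dl by rewrite !lt_min dl00 e10 divr_gt0.
have dl_0 : dl <= dl0 by rewrite ge_min lexx.
have dl_T : dl <= T / 4 by rewrite !ge_min lexx orbT.
have dl_e : dl <= e1 by rewrite !ge_min lexx !orbT.
pose s0 := sin (pi * a * dl) ^+ 2.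
have sP t : dl <= `|t| -> `|t| <= T - dl -> 0 < s0 <= sin (pi * a * t) ^+ 2.
  by apply: sin_away_ge => //; rewrite -/T; lra.
have s00 : 0 < s0.
  have := sP dl; rewrite gtr0_norm// => /(_ (lexx _)) H.
  by have /andP[] : 0 < s0 <= sin (pi * a * dl) ^+ 2 by apply: H; lra.
have mK : measurable K.
  by apply: closed_measurable; apply: compact_closed => //; exact: Rhausdorff.
pose B : R -> R := \1_(A `\` K).
pose G1 : R -> R := \1_(`[0, dl[%classic).
pose G2 : R -> R := \1_(`[T - dl, T[%classic).
have AT x : A x -> `|x| <= T by rewrite /A/= in_itv/= => /andP[x0 xT]; rewrite ger0_norm// ltW.
have tB : tame1 B.
  by apply: (@tame1_indic _ T); [exact: measurableD|move=> x [/AT]].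
have tG1 : tame1 G1.
  apply: (@tame1_indic _ T); first exact: measurable_itv.
  by move=> x /=; rewrite in_itv/= => /andP[x0 x1]; rewrite ger0_norm//; lra.
have tG2 : tame1 G2.
  apply: (@tame1_indic _ T); first exact: measurable_itv.
  by move=> x /=; rewrite in_itv/= => /andP[x0 x1]; rewrite ger0_norm//; lra.
have iB : int1 B <= e1.
  rewrite int1_indic; last exact: measurableD.
  have : (mu (A `\` K) \is a fin_num).
    by rewrite ge0_fin_numE// (lt_trans muK)// ltry.
  by move=> /fineK fK; rewrite -lee_fin fK ltW.
have iG1 : int1 G1 = dl.
  rewrite int1_indic; last exact: measurable_itv.
  by rewrite lebesgue_measure_itv/= lte_fin dlP oppr0 adde0.
have iG2 : int1 G2 = dl.
  rewrite int1_indic; last exact: measurable_itv.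
  rewrite lebesgue_measure_itv/= lte_fin ltrBlDr ltrDl dlP -EFinD /=; ring.
pose kap := C * (2 / s0).
have kap0 : 0 < kap by rewrite mulr_gt0// divr_gt0.
(* [kap] bounds the integrand off the diagonal uniformly in [N]; as the total
   mass of the kernel grows like [N], a large [N] makes that part negligible. *)
pose N := (Num.truncn (kap * T ^+ 2 * 2 / e)).+1.
have N0 : 0 < N%:R :> R by rewrite ltr0n.
have NP : kap * T ^+ 2 * 2 <= N%:R * e.
  rewrite -ler_pdivrMr//; apply/ltW.
  have h0 : 0 <= kap * T ^+ 2 * 2 / e.
    apply: divr_ge0; last exact: ltW.
    by apply: mulr_ge0 => //; exact: mulr_ge0 (ltW kap0) (sqr_ge0 _).
  by have /andP[_ h1] := truncn_itv h0; exact: h1.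
exists N.
have step : \sum_(j < N) \sum_(k < N) power a v (j%:Z - k%:Z) <=
    N%:R * \sum_(m <- zrange N) power a v m.
  apply: le_trans (_ : \sum_(j < N) \sum_(m <- zrange N) power a v m <= _); last first.
    by rewrite sumr_const card_ord -[leLHS]mulr_natl.
  apply: ler_sum => j _.
  rewrite -(big_mkord predT (fun k => power a v (j%:Z - k%:Z))).
  rewrite -(big_map (fun k : nat => j%:Z - k%:Z) predT (power a v)).
  apply: ler_sum_sub (zrange_uniq _) _ (power_ge0 a v).
    by rewrite map_inj_uniq ?iota_uniq// => i k; clear; lia.
  move=> m /mapP[k]; rewrite mem_index_iota mem_zrange => kN ->.
  have := ltn_ord j; clear - kN; lia.
have tc := cell_tame a0.
pose F (z : R * R) := fejer a N (z.1 - z.2).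
have bF : bounded_meas F := bounded_meas_fejer a N.
pose X (z : R * R) := cell a z.1 * cell a z.2 * (v z.1 - v z.2) ^+ 2 * F z.
pose Y (z : R * R) := C * ((B z.1 * cell a z.2 * F z + cell a z.1 * B z.2 * F z) +
   (G1 z.1 * cell a z.2 * F z + G2 z.1 * cell a z.2 * F z)) +
   (e2 * (cell a z.1 * cell a z.2 * F z) + kap * (cell a z.1 * cell a z.2)).
(* The four terms with the factor [C] cover a point outside [K] or a first
   coordinate within [dl] of an end of the cell, the term with [e2] the diagonal,
   the one with [kap] the rest of the square. *)
have XY z : X z <= Y z.
  have F0 : 0 <= F z := fejer_ge0 a N _.
  have ind0 (S : set R) x : 0 <= (\1_S x : R) by rewrite indicE ler0n.
  have [B1 B2 G10 G20] : [/\ 0 <= B z.1, 0 <= B z.2, 0 <= G1 z.1 & 0 <= G2 z.1].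
    by split; exact: ind0.
  have terms0 : 0 <= C * (B z.1 * F z + B z.2 * F z + (G1 z.1 * F z + G2 z.1 * F z)).
    by rewrite mulr_ge0 ?(ltW C0)// !addr_ge0// mulr_ge0.
  have e2F : 0 <= e2 * F z by rewrite mulr_ge0 ?(ltW e20).
  rewrite /X /Y; case: (cell_range a z.1) => [->|[-> x0T]].
    rewrite !(mul0r, mulr0, add0r, addr0) mulr_ge0 ?(ltW C0)//.
    by rewrite !addr_ge0// !mulr_ge0// cell_ge0.
  case: (cell_range a z.2) => [->|[-> y0T]].
    by rewrite !(mul0r, mulr0, mul1r, add0r, addr0) (mulr_ge0 (ltW C0))// mulr_ge0.
  rewrite -/T in x0T y0T; rewrite !mul1r !mulr1.
  have vC : (v z.1 - v z.2) ^+ 2 <= C.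
    have := vM z.1; have := vM z.2; rewrite !ler_norml => /andP[p1 p2] /andP[p3 p4].
    by rewrite /C; nra.
  have big : 1 <= B z.1 + B z.2 + (G1 z.1 + G2 z.1) ->
      (v z.1 - v z.2) ^+ 2 * F z <=
      C * (B z.1 * F z + B z.2 * F z + (G1 z.1 * F z + G2 z.1 * F z)) + (e2 * F z + kap).
    move=> h; apply: le_trans (_ : C * F z <= _); first by rewrite ler_wpM2r.
    have : C * F z * 1 <= C * F z * (B z.1 + B z.2 + (G1 z.1 + G2 z.1)).
      by rewrite ler_wpM2l// mulr_ge0// ltW.
    by rewrite mulr1; have := kap0; lra.
  have Ax : A z.1 by rewrite /A/= in_itv.
  have Ay : A z.2 by rewrite /A/= in_itv.
  have [Kx|Kx] := pselect (K z.1); last first.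
    apply: big; have -> : B z.1 = 1 by rewrite /B indicE mem_set.
    by lra.
  have [Ky|Ky] := pselect (K z.2); last first.
    apply: big; have -> : B z.2 = 1 by rewrite /B indicE mem_set.
    by lra.
  have /andP[x0 xT] := x0T; have /andP[y0 yT] := y0T.
  have [xdl|xdl] := ltP z.1 dl.
    apply: big; have -> : G1 z.1 = 1 by rewrite /G1 indicE mem_set//= in_itv/= x0.
    by lra.
  have [xdl'|xdl'] := leP (T - dl) z.1.
    apply: big; have -> : G2 z.1 = 1 by rewrite /G2 indicE mem_set//= in_itv/= xdl'.
    by lra.
  have [near_|far] := ltP `|z.1 - z.2| dl.
    have := hdl _ _ Kx Ky (lt_le_trans near_ dl_0) => hv.
    have : (v z.1 - v z.2) ^+ 2 <= e2.
      rewrite -(real_normK (num_real _)) -(sqr_sqrtr (ltW e20)).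
      by rewrite ler_sqr ?nnegrE// ltW.
    move=> hv2; have : (v z.1 - v z.2) ^+ 2 * F z <= e2 * F z by rewrite ler_wpM2r.
    by have := kap0; lra.
  have far2 : `|z.1 - z.2| <= T - dl by rewrite ler_norml; apply/andP; split; lra.
  have /andP[_ sz] := sP _ far far2.
  have Fs : F z <= 2 / s0.
    rewrite ler_pdivlMr//; apply: le_trans (fejer_sin_le a N (z.1 - z.2)).
    by rewrite ler_wpM2l.
  have : (v z.1 - v z.2) ^+ 2 * F z <= kap.
    by rewrite /kap ler_pM// sqr_ge0.
  by lra.
have tt (f g : R -> R) : tame1 f -> tame1 g ->
    tame2 (fun z : R * R => f z.1 * g z.2 * F z).
  by move=> tf tg; apply: tameM (tame2_tensor tf tg) bF.
have [t1 t2 t3] := And3 (tt _ _ tB tc) (tt _ _ tc tB) (tt _ _ tG1 tc).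
have [t4 t5] := (tt _ _ tG2 tc, tt _ _ tc tc).
have t6 := tame2_tensor tc tc.
have tY1 := tameD (tameD t1 t2) (tameD t3 t4).
have tY2 := tameD (tameZ e2 t5) (tameZ kap t6).
have tY : tame2 Y := tameD (tameZ C tY1) tY2.
have tX : tame2 X.
  have bv := tame_bounded tv.
  have bd := bounded_measD (bounded_meas_fst bv)
    (bounded_measM (bounded_meas_cst _ (-1)) (bounded_meas_snd bv)).
  apply: eq_tame (tameM (tameM t6 (bounded_measM bd bd)) bF) _ => z.
  by rewrite /X expr2 !mulN1r.
have iY : int2 Y = C * ((N%:R * T * int1 B + N%:R * T * int1 B) + (N%:R * T * dl + N%:R * T * dl))
    + (e2 * (N%:R * T * T) + kap * (T * T)).
  rewrite /Y (int2D (tameZ C tY1) tY2) (int2Z C tY1).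
  rewrite (int2D (tameD t1 t2) (tameD t3 t4)) (int2D t1 t2) (int2D t3 t4).
  rewrite (int2D (tameZ e2 t5) (tameZ kap t6)) (int2Z e2 t5) (int2Z kap t6).
  rewrite /F !int2_fejer_cellr// int2_fejer_celll// int2_tensor// int1_cell.
  by rewrite iG1 iG2.
have := int2_le tX tY XY; rewrite iY /X /F fejer_defect// -/T => H.
rewrite -(ler_pM2l N0); apply: le_trans (step); move: H.
set I := int1 _; set S := \sum_(j < N) _ => H.
have E1 : N%:R * (C * T * e1 * 4) = N%:R * e.
  by rewrite /e1; congr (_ * _); field; rewrite !gt_eqF.
have E2 : e2 * (N%:R * T * T) = N%:R * e / 2.
  by rewrite /e2; field; rewrite gt_eqF.
have CT : 0 <= N%:R * (C * T) by exact: mulr_ge0 (ltW N0) (mulr_ge0 (ltW C0) (ltW T0)).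
have := ler_wpM2l CT iB; have := ler_wpM2l CT dl_e; lra.
Qed.

End parseval.

(** * Parseval's inequalities in the plane *)

Lemma Rintegral_dominated_cvg d (T : measurableType d) (R : realType)
    (mu : {measure set T -> \bar R}) (f_ : nat -> T -> R) (f g : T -> R) :
  (forall n, measurable_fun setT (f_ n)) -> measurable_fun setT f ->
  mu.-integrable setT (EFin \o g) ->
  (forall n x, `|f_ n x| <= g x) -> (forall x, f_ ^~ x @ \oo --> f x) ->
  Rintegral mu setT (f_ n) @[n --> \oo] --> Rintegral mu setT f.
Proof.
move=> mf_ mf ig fg ff.
have [|||||iF _ cF] := @dominated_convergence _ _ _ mu setT measurableT
    (fun n => EFin \o f_ n) (EFin \o f) (EFin \o g).
- by move=> n; exact/measurable_EFinP.
- exact/measurable_EFinP.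
- apply: aeW => x _; apply: cvg_EFin; first exact: nearW.
  by apply: cvg_trans (ff x); apply: near_eq_cvg; exact: nearW.
- exact: ig.
- by apply: aeW => x n _ /=; rewrite lee_fin.
rewrite /Rintegral; apply: fine_cvg.
rewrite fineK//; exact: integrable_fin_num.
Qed.

Section parseval2.
Context (R : realType).
Variables a b : R.
Hypotheses (a0 : 0 < a) (b0 : 0 < b).

Definition coef2 (e1 e2 : bool) (k l : int) (W : R * R -> R) : R :=
  int2 (fun z => W z * (wave e1 (a * k%:~R) z.1 * wave e2 (b * l%:~R) z.2)).

(** For a real [W], the mean of the squared moduli of the complex Fourier
    coefficients at the frequencies [(k, l)] and [(k, - l)]. *)
Definition power2 (W : R * R -> R) (k l : int) : R :=
  \sum_(e1 <- [:: false; true]) \sum_(e2 <- [:: false; true]) coef2 e1 e2 k l W ^+ 2.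

Lemma power2_ge0 W k l : 0 <= power2 W k l.
Proof. by apply: sumr_ge0 => e1 _; apply: sumr_ge0 => e2 _; exact: sqr_ge0. Qed.

Definition supported2 (W : R * R -> R) :=
  forall z, W z = W z * (cell a z.1 * cell b z.2).

Variable W : R * R -> R.
Hypotheses (tW : tame2 W) (sW : supported2 W).

(** The Fourier coefficients in the second variable, as functions of the first;
    the results on the line are applied to the slices of [W] and then to them. *)
Let V l e2 x := coef b e2 l (fun y => W (x, y)).

Let tWw l e2 : tame2 (fun z => W z * wave e2 (b * l%:~R) z.2).
Proof.
exact: tameM tW (bounded_meas_snd (wave_bounded e2 (b * l%:~R))).
Qed.

Let tV l e2 : tame1 (V l e2).
Proof. exact: tame1_int (tWw l e2). Qed.

Let sV l e2 : supported a (V l e2).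
Proof.
move=> x; have [E|[-> _]] := cell_range a x; last by rewrite mulr1.
rewrite E mulr0 /V /coef (_ : (fun y => _) = fun=> 0); first exact: tame_int0.
by apply/funext => y; rewrite sW /= E !(mul0r, mulr0).
Qed.

Let tslice x : tame1 (fun y => W (x, y)) := tame1_slice x tW.

Let sslice x : supported b (fun y => W (x, y)).
Proof.
move=> y; rewrite sW /=; case: (cell_range a x) => [->|[-> _]].
  by rewrite !(mul0r, mulr0).
by rewrite mul1r -!mulrA cell_idem.
Qed.

Let tsq : tame2 (fun z => W z ^+ 2).
Proof. by apply: eq_tame (tameM tW (tame_bounded tW)) _ => z; rewrite expr2. Qed.

Let tVsq l e2 : tame1 (fun x => V l e2 x ^+ 2).
Proof. by apply: eq_tame (tameM (tV l e2) (tame_bounded (tV l e2))) _ => z; rewrite expr2. Qed.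

Let coef2E e1 e2 k l : coef2 e1 e2 k l W = coef a e1 k (V l e2).
Proof.
rewrite /coef2 int2E; last first.
  apply: tameM tW _; apply: bounded_measM.
    exact: bounded_meas_fst (wave_bounded _ _).
  exact: bounded_meas_snd (wave_bounded _ _).
rewrite /coef; congr int1; apply/funext => x /=.
rewrite /V /coef [RHS]mulrC -[RHS](int1Z _ (tame1_slice x (tWw l e2))).
by congr int1; apply/funext => y /=; ring.
Qed.

Let power2E k l : power2 W k l = \sum_(e2 <- [:: false; true]) power a (V l e2) k.
Proof.
rewrite /power2 exchange_big/=; apply: eq_bigr => e2 _.
by rewrite big_cons big_seq1 !coef2E.
Qed.

Let sum_powerE M x : \sum_(l <- zrange M) power b (fun y => W (x, y)) l =
  \sum_(l <- zrange M) \sum_(e2 <- [:: false; true]) V l e2 x ^+ 2.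
Proof. by apply: eq_bigr => l _; rewrite big_cons big_seq1. Qed.

Let g x := int1 (fun y => W (x, y) ^+ 2).

Let tg : tame1 g. Proof. exact: (tame1_int tsq). Qed.

Let int_g : int1 g = int2 (fun z => W z ^+ 2).
Proof. by rewrite (int2E tsq). Qed.

Let P M x := \sum_(l <- zrange M) power b (fun y => W (x, y)) l.

Let tP M : tame1 (P M).
Proof.
apply: (@eq_tame _ _ _ _ (fun x => \sum_(l <- zrange M) \sum_(e2 <- [:: false; true]) V l e2 x ^+ 2)).
  by apply: tame_sum => l; apply: tame_sum => e2; exact: tVsq.
by move=> x; rewrite /P sum_powerE.
Qed.

Let int_P M : int1 (P M) =
  \sum_(l <- zrange M) \sum_(e2 <- [:: false; true]) int1 (fun x => V l e2 x ^+ 2).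
Proof.
rewrite (_ : P M = fun x => \sum_(l <- zrange M) \sum_(e2 <- [:: false; true]) V l e2 x ^+ 2).
  rewrite int1_sum; last by move=> l; apply: tame_sum => e2; exact: tVsq.
  by apply: eq_bigr => l _; rewrite int1_sum.
by apply/funext => x; rewrite /P sum_powerE.
Qed.

Lemma bessel2 N M :
  \sum_(l <- zrange M) \sum_(k <- zrange N) power2 W k l <=
  4 * a^-1 * b^-1 * int2 (fun z => W z ^+ 2).
Proof.
apply: le_trans (_ : _ <= 2 * a^-1 * int1 (P M)) _.
  rewrite int_P mulr_sumr; apply: ler_sum => l _.
  under eq_bigr do rewrite power2E.
  rewrite exchange_big/= mulr_sumr; apply: ler_sum => e2 _.
  exact: bessel.
rewrite -int_g (_ : 4 * a^-1 * b^-1 * int1 g = 2 * a^-1 * (2 * b^-1 * int1 g)); last by ring.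
rewrite ler_wpM2l ?mulr_ge0 ?invr_ge0 ?(ltW a0)// -(int1Z (2 * b^-1) tg).
by apply: int1_le (tP M) (tameZ _ tg) _ => x; exact: bessel.
Qed.

(** Integrating the lower bounds for the slices of [W] over the first variable
    leaves finitely many functions [V l e2], to each of which the lower bound
    on the line applies again. *)
Lemma parseval2_lower (e : R) : 0 < e ->
  exists N, a^-1 * b^-1 * int2 (fun z => W z ^+ 2) - e <=
    \sum_(l <- zrange N) \sum_(k <- zrange N) power2 W k l.
Proof.
move=> e0.
have ai0 : 0 < a^-1 by rewrite invr_gt0.
have bi0 : 0 < b^-1 by rewrite invr_gt0.
have e10 : 0 < e / 2 / a^-1 by rewrite !divr_gt0.
have [M hM] : exists M, b^-1 * int1 g - e / 2 / a^-1 <= int1 (P M).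
  (* The lower bounds for the slices are not uniform in [x].  Capped at their
     limit the partial sums converge, and the cap dominates them. *)
  pose h M x := Num.min (P M x) (b^-1 * g x).
  have g0 x : 0 <= b^-1 * g x.
    by rewrite mulr_ge0 ?(ltW bi0)//; apply: tame_int_ge0 => y; exact: sqr_ge0.
  have P0 M x : 0 <= P M x by apply: sumr_ge0 => l _; exact: power_ge0.
  have th M : tame1 (h M).
    have [[mp [K hK]] [mg [L hL]]] := (tP M, tameZ b^-1 tg).
    split; first exact: measurable_minr.
    exists (Num.max K L) => x; have [p1 p2] := hK x; have [q1 q2] := hL x; split.
      rewrite ger0_norm ?le_min ?P0 ?g0// le_max; apply/orP; left.
      by rewrite ge_min (le_trans (ler_norm _) p1).
    by rewrite gt_max => /andP[/p2 H1 /q2 H2]; rewrite /h H1 H2 minxx.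
  have cvP : int1 (h n) @[n --> \oo] --> int1 (fun x => b^-1 * g x).
    apply: (@Rintegral_dominated_cvg _ _ R (@lebesgue_measure R) h
      (fun x => b^-1 * g x) (fun x => b^-1 * g x)) => [n|||n x|x].
    - by case: (th n).
    - by case: (tameZ b^-1 tg).
    - exact: tame1_integrable (tameZ b^-1 tg).
    - by rewrite ger0_norm ?ge_min ?lexx ?orbT// le_min P0 g0.
    - apply/cvgrPdist_lt => e2 e20.
      have e22 : 0 < e2 / 2 by rewrite divr_gt0.
      have [N hN] := parseval_lower b0 (tslice x) (sslice x) e22.
      near=> n; have Nn : (N <= n)%N by near: n; exact: nbhs_infty_ge.
      rewrite ger0_norm ?subr_ge0 ?ge_min ?lexx ?orbT//.
      have : P N x <= P n x.
        by apply: ler_sum_sub (zrange_uniq _) (zrange_uniq _) (zrange_sub Nn) (power_ge0 _ _).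
      rewrite -/(P N x) -/(g x) in hN => PN.
      by rewrite /h; case: (leP (P n x)) => _; lra.
  have /cvgrPdist_lt /(_ _ e10) [N _ /(_ N (leqnn N)) /= HN] := cvP.
  exists N; have hP : int1 (h N) <= int1 (P N).
    by apply: int1_le (th N) (tP N) _ => x; rewrite /h ge_min lexx.
  move: HN; rewrite int1Z//.
  by move=> /(le_lt_trans (ler_norm _)); lra.
pose n0 := (size (zrange M) * 2)%:R : R.
have n00 : 0 < n0.
  by rewrite ltr0n muln_gt0 andbT size_map size_iota.
have e30 : 0 < e / 2 / n0 by rewrite !divr_gt0.
have hN l e2 := parseval_lower a0 (tV l e2) (sV l e2) e30.
have [N MN hNN] : exists2 N, (M <= N)%N & forall l e2, l \in zrange M ->
    a^-1 * int1 (fun x => V l e2 x ^+ 2) - e / 2 / n0 <= \sum_(m <- zrange N) power a (V l e2) m.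
  have [f fP] : exists f : int -> bool -> nat, forall l e2,
      a^-1 * int1 (fun x => V l e2 x ^+ 2) - e / 2 / n0 <=
      \sum_(m <- zrange (f l e2)) power a (V l e2) m.
    by exists (fun l e2 => projT1 (cid (hN l e2))) => l e2; case: (cid (hN l e2)).
  exists (M + \sum_(l <- zrange M) (f l false + f l true))%N; first exact: leq_addr.
  move=> l e2 lM; apply: le_trans (fP l e2) _.
  apply: ler_sum_sub (zrange_uniq _) (zrange_uniq _) (zrange_sub _) (power_ge0 _ _).
  rewrite (big_rem _ lM)/=.
  apply: leq_trans (leq_addl M _); apply: leq_trans (leq_addr _ _).
  by case: (e2); rewrite ?leq_addl ?leq_addr.
exists N.
apply: le_trans (_ : \sum_(l <- zrange M) \sum_(k <- zrange N) power2 W k l <= _); last first.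
  apply: ler_sum_sub (zrange_uniq _) (zrange_uniq _) (zrange_sub MN) _ => l.
  by apply: sumr_ge0 => k _; exact: power2_ge0.
apply: le_trans (_ : \sum_(l <- zrange M) \sum_(e2 <- [:: false; true])
   (a^-1 * int1 (fun x => V l e2 x ^+ 2) - e / 2 / n0) <= _); last first.
  rewrite big_seq [leRHS]big_seq; apply: ler_sum => l lM.
  under [leRHS]eq_bigr do rewrite power2E.
  by rewrite [leRHS]exchange_big/=; apply: ler_sum => e2 _; exact: hNN.
have -> : \sum_(l <- zrange M) \sum_(e2 <- [:: false; true])
   (a^-1 * int1 (fun x => V l e2 x ^+ 2) - e / 2 / n0) = a^-1 * int1 (P M) - e / 2.
  rewrite int_P mulr_sumr.
  have n1 : (size (zrange M))%:R != 0 :> R by rewrite pnatr_eq0 size_map size_iota.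
  rewrite [X in _ = _ - X](_ : _ = \sum_(l <- zrange M) (e / 2 / n0 * 2)); last first.
    by rewrite big_const_seq count_predT iter_addr_0 -mulr_natl /n0 natrM; field.
  rewrite -sumrB; apply: eq_bigr => l _.
  rewrite 2!big_cons big_nil 2!big_cons big_nil.
  by move: (int1 _) (int1 _) => i1 i2; ring.
rewrite -int_g; have := ler_wpM2l (ltW ai0) hM.
have -> : a^-1 * (b^-1 * int1 g - e / 2 / a^-1) = a^-1 * b^-1 * int1 g - e / 2.
  by field; rewrite !gt_eqF.
lra.
Unshelve. all: by end_near. Qed.

End parseval2.

(** * Periodization *)

Section periodization.
Context (R : realType).
Variables a b : R.
Hypotheses (a0 : 0 < a) (b0 : 0 < b).

Definition zbox (N : nat) : seq (int * int) :=
  [seq (j1, j2) | j1 <- zrange N, j2 <- zrange N].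

Lemma zbox_uniq N : uniq (zbox N).
Proof. by rewrite allpairs_pair_uniq ?zrange_uniq. Qed.

Lemma cell_tiling (s : R) (x : R) N : 0 < s -> `|x| <= N%:R / s ->
  \sum_(j <- zrange N) cell s (x - j%:~R / s) = 1.
Proof.
move=> s0 xN; pose j0 := Num.floor (x / s^-1).
have si0 : 0 < s^-1 by rewrite invr_gt0.
have cellE (j : int) : cell s (x - j%:~R / s) = (j == j0)%:R.
  rewrite /cell indicE; congr ((nat_of_bool _)%:R); apply/idP/eqP.
    rewrite inE/= in_itv/= => /andP[h1 h2]; apply/esym/floor_def.
    rewrite ler_pdivlMr// ltr_pdivrMr// intrD mulrDl mul1r; apply/andP; split; lra.
  by move=> ->; rewrite inE/= in_itv/=; exact: floor_mod.
under eq_bigr do rewrite cellE.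
rewrite (bigD1_seq j0) ?zrange_uniq//=.
  by rewrite eqxx big1 ?addr0// => j /negPf ->.
have /andP[f1 f2] := floor_itv (x / s^-1).
have h : `|x / s^-1| <= N%:R.
  by rewrite normrM invrK (gtr0_norm s0) -ler_pdivlMr.
rewrite mem_zrange; move: h f1 f2; rewrite -/j0 ler_norml => /andP[h1 h2] f1 f2.
have l1 : - N%:Z - 1 < j0.
  rewrite -(ltr_int R) intrD !mulrNz -pmulrn; rewrite intrD in f2; lra.
have l2 : j0 <= N%:Z by rewrite -(ler_int R) -pmulrn; lra.
clear - l1 l2; lia.
Qed.

Definition shiftz (j : int * int) (z : R * R) : R * R :=
  (z.1 + j.1%:~R / a, z.2 + j.2%:~R / b).

Definition cell2 (z : R * R) : R := cell a z.1 * cell b z.2.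

(** For a [w] supported in the box of half-widths [N / a] and [N / b] this is the
    full periodization, restricted to one cell. *)
Definition periodize (N : nat) (w : R * R -> R) (z : R * R) : R :=
  (\sum_(j <- zbox N) w (shiftz j z)) * cell2 z.

Lemma cell2_bounded : bounded_meas cell2.
Proof.
by apply: bounded_measM; [apply: bounded_meas_fst|apply: bounded_meas_snd];
  apply: tame_bounded; exact: cell_tame.
Qed.

Lemma periodize_tame N w : tame2 w -> tame2 (periodize N w).
Proof.
move=> tw; apply: tameM cell2_bounded; apply: tame_sum => j.
exact: tame2_translate tw.
Qed.

Lemma periodize_supported N w : supported2 a b (periodize N w).
Proof.
move=> z; rewrite /periodize /cell2 -mulrA; congr (_ * _).
by rewrite mulrACA !cell_idem.
Qed.

Lemma cell2_tiling N z : `|z.1| <= N%:R / a -> `|z.2| <= N%:R / b ->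
  \sum_(j <- zbox N) cell2 (z.1 - j.1%:~R / a, z.2 - j.2%:~R / b) = 1.
Proof.
move=> z1 z2; rewrite big_allpairs_dep/= /cell2/=.
under eq_bigr do rewrite -mulr_sumr cell_tiling// mulr1.
exact: cell_tiling.
Qed.

Lemma exists_support_box u : tame2 u -> exists N : nat,
  forall z, u z != 0 -> (`|z.1| <= N%:R / a) && (`|z.2| <= N%:R / b).
Proof.
move=> [_ [M hM]]; exists (Num.truncn (`|M| * a) + Num.truncn (`|M| * b)).+1 => z uz.
have {hM uz}zM : gauge2 z <= `|M|.
  apply: le_trans (ler_norm M); rewrite leNgt; apply/negP => h.
  by have [_ /(_ h) E] := hM z; rewrite E eqxx in uz.
move: zM; rewrite /gauge2 ge_max => /andP[z1 z2].
have h (s : R) n : 0 < s -> (Num.truncn (`|M| * s) <= n)%N -> `|M| <= n.+1%:R / s.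
  move=> s0 sn; rewrite ler_pdivlMr//.
  have : 0 <= `|M| * s by rewrite mulr_ge0// ltW.
  move=> /truncn_itv/andP[_ /ltW /le_trans]; apply.
  by rewrite ler_nat ltnS.
by rewrite (le_trans z1 (h _ _ _ _)) ?leq_addr// (le_trans z2 (h _ _ _ _)) ?leq_addl.
Qed.

(** The translates of the cell tile the support of [w]; each piece of the
    integral is translated back to the cell, where [phi] is unchanged. *)
Lemma int2_periodize N w phi : tame2 w -> bounded_meas phi ->
  (forall j z, phi (shiftz j z) = phi z) ->
  (forall z, w z != 0 -> (`|z.1| <= N%:R / a) && (`|z.2| <= N%:R / b)) ->
  int2 (fun z => w z * phi z) = int2 (fun z => periodize N w z * phi z).
Proof.
move=> tw bphi phiE wN.
have tj (j : int * int) : tame2 (fun z => w (shiftz j z) * (cell2 z * phi z)).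
  by apply: tameM (bounded_measM cell2_bounded bphi); exact: tame2_translate tw.
have tj' (j : int * int) : tame2 (fun z => w z * (cell2 (shiftz (- j.1, - j.2) z) * phi z)).
  apply: eq_tame (tame2_translate (- j.1%:~R / a) (- j.2%:~R / b) (tj j)) _ => z.
  have E : shiftz j (z.1 + - j.1%:~R / a, z.2 + - j.2%:~R / b) = z.
    by rewrite /shiftz/= !mulNr !subrK; case: z.
  have Ep : phi (z.1 + - j.1%:~R / a, z.2 + - j.2%:~R / b) = phi z by rewrite -(phiE j) E.
  by rewrite E Ep /shiftz/= !mulrNz.
have -> : (fun z => w z * phi z) =
    fun z => \sum_(j <- zbox N) w z * (cell2 (shiftz (- j.1, - j.2) z) * phi z).
  apply/funext => z; rewrite -mulr_sumr; have [->|/wN/andP[z1 z2]] := eqVneq (w z) 0.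
    by rewrite !mul0r.
  congr (_ * _); rewrite -mulr_suml (_ : \sum_(j <- _) _ = 1) ?mul1r//.
  rewrite -(cell2_tiling z1 z2); apply: eq_bigr => j _.
  by rewrite /shiftz /= !mulrNz !mulNr.
rewrite int2_sum//.
have -> : (fun z => periodize N w z * phi z) =
    fun z => \sum_(j <- zbox N) w (shiftz j z) * (cell2 z * phi z).
  by apply/funext => z; rewrite /periodize -mulrA mulr_suml.
rewrite int2_sum//; apply: eq_bigr => j _.
rewrite -(int2_translate (j.1%:~R / a) (j.2%:~R / b) (tj' j)).
congr int2; apply/funext => z.
rewrite -/(shiftz j z) phiE; congr (_ * (cell2 _ * _)).
by rewrite /shiftz/= !mulrNz !mulNr !addrK; case: z.
Qed.

Lemma wave_periodic (s : R) e (k j : int) x : 0 < s ->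
  wave e (s * k%:~R) (x + j%:~R / s) = wave e (s * k%:~R) x.
Proof.
move=> s0; rewrite /wave.
have -> : 2 * pi * (s * k%:~R) * (x + j%:~R / s) =
    2 * pi * (s * k%:~R) * x + 2 * pi * (k * j)%:~R.
  by rewrite intrM; field; rewrite gt_eqF.
rewrite sinD cosD cos_2pi_int sin_2pi_int.
by case: e; rewrite ?mulr1 ?mulr0 ?addr0 ?subr0.
Qed.

Lemma coef2_periodize N w e1 e2 k l : tame2 w ->
  (forall z, w z != 0 -> (`|z.1| <= N%:R / a) && (`|z.2| <= N%:R / b)) ->
  coef2 a b e1 e2 k l w = coef2 a b e1 e2 k l (periodize N w).
Proof.
move=> tw wN.
apply: (int2_periodize (phi := fun z => wave e1 (a * k%:~R) z.1 * wave e2 (b * l%:~R) z.2)) => //.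
  apply: bounded_measM.
    exact: bounded_meas_fst (wave_bounded _ _).
  exact: bounded_meas_snd (wave_bounded _ _).
by move=> j z; rewrite /shiftz/= !wave_periodic.
Qed.

Lemma power2_periodize N w k l : tame2 w ->
  (forall z, w z != 0 -> (`|z.1| <= N%:R / a) && (`|z.2| <= N%:R / b)) ->
  power2 a b w k l = power2 a b (periodize N w) k l.
Proof.
move=> tw wN; apply: eq_bigr => e1 _; apply: eq_bigr => e2 _.
by rewrite (coef2_periodize _ _ _ _ tw wN).
Qed.

Lemma int2_periodize1 N w : tame2 w ->
  (forall z, w z != 0 -> (`|z.1| <= N%:R / a) && (`|z.2| <= N%:R / b)) ->
  int2 w = int2 (periodize N w).
Proof.
move=> tw wN; have := int2_periodize (phi := fun=> 1) tw (bounded_meas_cst _ 1) _ wN.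
move=> /(_ (fun _ _ => erefl)) H.
transitivity (int2 (fun z => w z * 1)); first by congr int2; apply/funext => z; rewrite mulr1.
by rewrite H; congr int2; apply/funext => z; rewrite mulr1.
Qed.

End periodization.

(** * The frame inequalities for bounded functions with bounded support *)

Section gaussian_lattice.
Context (R : realType).
Variables (p q : int) (a b c d alpha : R).
Hypotheses (pq : coprimez p q) (a0 : 0 < a) (b0 : 0 < b) (c0 : 0 < c) (d0 : 0 < d).
Hypothesis alpha0 : 0 < alpha.
Let sigma : R := Num.sqrt (p%:~R ^+ 2 + q%:~R ^+ 2).
Let beta : R := alpha * (b ^+ 2 / a ^+ 2).
Hypothesis cd : (c < 1 /\ d < 1) \/ (c < sigma ^+ 2 /\ d < sigma ^- 2).

Definition window (z : R * R) : R := expR (- (alpha * z.1 ^+ 2 + beta * z.2 ^+ 2)).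

Definition node (t : int * int) : R * R :=
  (p%:~R / (a * sigma) * (c / sigma * t.1%:~R) - q%:~R / (a * sigma) * (d * sigma * t.2%:~R),
   q%:~R / (b * sigma) * (c / sigma * t.1%:~R) + p%:~R / (b * sigma) * (d * sigma * t.2%:~R)).

Definition shifted_window (t : int * int) (z : R * R) : R :=
  window (z.1 - (node t).1, z.2 - (node t).2).

Lemma sigma_gt0 : 0 < sigma.
Proof. by rewrite sqrtr_gt0 (norm_pq_gt0 R pq). Qed.

Lemma sigma_sqr : sigma ^+ 2 = p%:~R ^+ 2 + q%:~R ^+ 2.
Proof. by rewrite sqr_sqrtr// ltW// (norm_pq_gt0 R pq). Qed.

Let rot1 (z : R * R) : R := (p%:~R * (a * z.1) + q%:~R * (b * z.2)) / sigma.
Let rot2 (z : R * R) : R := (- q%:~R * (a * z.1) + p%:~R * (b * z.2)) / sigma.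

(** In the rotated coordinates the anisotropic Gaussian is a product of two
    Gaussians of the same width, and the time lattice is rectangular. *)
Lemma shifted_window_rot t j z : shifted_window t (shiftz a b j z) =
  gauss (alpha / a ^+ 2)
     (rot1 z + (p * j.1 + q * j.2)%:~R / sigma - t.1%:~R * (c / sigma)) *
  gauss (alpha / a ^+ 2)
     (rot2 z + (- q * j.1 + p * j.2)%:~R / sigma - t.2%:~R * (d * sigma)).
Proof.
have s0 := sigma_gt0; rewrite /shifted_window /window /gauss -expRD; congr expR.
rewrite /shiftz /node /rot1 /rot2 /beta /= !intrD !intrM mulrNz.
move: sigma_sqr; move: sigma s0 => s s0 sE.
move: (t.1%:~R : R) (t.2%:~R : R) (j.1%:~R : R) (j.2%:~R : R) sE => m n j1 j2.
move: (p%:~R : R) (q%:~R : R) => P Q sE.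
pose x := a * z.1 + j1; pose y := b * z.2 + j2.
pose u := c / s * m; pose v := d * s * n.
have sV : s * s^-1 = 1 by rewrite divff// gt_eqF.
transitivity (- alpha / a ^+ 2 * ((x - (P * u - Q * v) / s) ^+ 2 + (y - (Q * u + P * v) / s) ^+ 2)).
  by rewrite /x /y /u /v; field; rewrite !gt_eqF.
have -> : (x - (P * u - Q * v) / s) ^+ 2 + (y - (Q * u + P * v) / s) ^+ 2 =
   ((P * x + Q * y) / s - u) ^+ 2 + ((- Q * x + P * y) / s - v) ^+ 2.
  apply/eqP; rewrite -subr_eq0; move: x y u v => x y u v.
  have -> : (x - (P * u - Q * v) / s) ^+ 2 + (y - (Q * u + P * v) / s) ^+ 2 -
     (((P * x + Q * y) / s - u) ^+ 2 + ((- Q * x + P * y) / s - v) ^+ 2) =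
     (x ^+ 2 + y ^+ 2 - (u ^+ 2 + v ^+ 2)) * (1 - (P ^+ 2 + Q ^+ 2) / s ^+ 2).
    by field; rewrite gt_eqF.
  by rewrite -sE divff ?subrr ?mulr0// sqrf_eq0 gt_eqF.
by rewrite /x /y /u /v; field; rewrite !gt_eqF.
Qed.

Lemma window_bounded : bounded_meas window.
Proof.
split.
  apply: measurableT_comp => //; apply: measurableT_comp => //.
  apply: measurable_funD; apply: measurable_funM => //.
    by apply: measurable_funX; exact: measurable_fst.
  by apply: measurable_funX; exact: measurable_snd.
exists 1 => z; rewrite ger0_norm ?expR_ge0// -expR0 ler_expR oppr_le0.
rewrite addr_ge0// mulr_ge0 ?sqr_ge0 ?(ltW alpha0)// /beta.
by rewrite mulr_ge0 ?(ltW alpha0)// divr_ge0// exprn_ge0// ltW.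
Qed.

Lemma shifted_window_bounded t : bounded_meas (shifted_window t).
Proof.
have [mw [M wM]] := window_bounded; split; last by exists M => z; exact: wM.
by apply: (measurableT_comp mw); apply: measurable_fun_pair; apply: measurable_funB.
Qed.

Definition energy (F : seq (int * int)) (N : nat) (u : R * R -> R) : R :=
  \sum_(t <- F) \sum_(l <- zrange N) \sum_(k <- zrange N)
    power2 a b (fun z => u z * shifted_window t z) k l.

Definition norm2 (u : R * R -> R) : R := int2 (fun z => u z ^+ 2).

(** The kernel of [shifted_window_rot] as a function of the rotated offset. *)
Let K x y (j t : int * int) : R :=
  gauss (alpha / a ^+ 2) (x + (p * j.1 + q * j.2)%:~R / sigma - t.1%:~R * (c / sigma)) *
  gauss (alpha / a ^+ 2) (y + (- q * j.1 + p * j.2)%:~R / sigma - t.2%:~R * (d * sigma)).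

Let sampling : stable_sampling K.
Proof.
by apply: stable_sampling_rotated => //; rewrite divr_gt0// exprn_gt0.
Qed.

Lemma periodize_square (N : nat) (u : R * R -> R) t z :
  periodize a b N (fun z => u z * shifted_window t z) z =
  (\sum_(j <- zbox N) u (shiftz a b j z) * K (rot1 z) (rot2 z) j t) * cell2 a b z.
Proof.
by rewrite /periodize; congr (_ * _); apply: eq_bigr => j _; rewrite shifted_window_rot.
Qed.

Lemma rot_bounded z : 0 <= z.1 < a^-1 -> 0 <= z.2 < b^-1 ->
  `|rot1 z| <= (`|p%:~R| + `|q%:~R|) / sigma /\
  `|rot2 z| <= (`|p%:~R| + `|q%:~R|) / sigma.
Proof.
move=> /andP[x0 x1] /andP[y0 y1].
have sV : 0 < sigma^-1 by rewrite invr_gt0 sigma_gt0.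
have x1' : `|a * z.1| <= 1.
  by rewrite ger0_norm ?mulr_ge0 ?(ltW a0)// mulrC -ler_pdivlMr// mul1r ltW.
have y1' : `|b * z.2| <= 1.
  by rewrite ger0_norm ?mulr_ge0 ?(ltW b0)// mulrC -ler_pdivlMr// mul1r ltW.
have h (u v x y : R) : `|x| <= 1 -> `|y| <= 1 -> `|(u * x + v * y) / sigma| <= (`|u| + `|v|) / sigma.
  move=> hx hy; rewrite normrM (gtr0_norm sV) ler_pM2r//.
  by rewrite (le_trans (ler_normD _ _))// !normrM lerD// ler_piMr.
split; first exact: h.
by rewrite addrC -(normrN q%:~R); exact: h.
Qed.

(** Inside the cell [sampling] compares the sum over [t] of the squared
    periodizations of [u * shifted_window t] with the periodization of [u ^+ 2],
    pointwise; integration and Parseval's inequalities give the rest.  For the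
    lower bound the rotated offsets stay bounded by [rot_bounded], so one finite
    set of [t] serves the whole cell. *)
Theorem tame_frame : exists A B : R, [/\ 0 < A, 0 < B &
  forall u, tame2 u ->
    (forall F M, uniq F -> energy F M u <= B * norm2 u) /\
    (forall e, 0 < e -> exists F M, uniq F /\ A * norm2 u - e <= energy F M u)].
Proof.
have [[B B0 hB] [A A0 hA]] := sampling.
have ai0 : 0 < a^-1 by rewrite invr_gt0.
have bi0 : 0 < b^-1 by rewrite invr_gt0.
exists (a^-1 * b^-1 * A), (4 * a^-1 * b^-1 * B); split; [by rewrite !mulr_gt0..|].
move=> u tu; have [N uN] := exists_support_box a0 b0 tu.
have tw t : tame2 (fun z => u z * shifted_window t z).
  exact: tameM tu (shifted_window_bounded t).
have tsq (w : R * R -> R) : tame2 w -> tame2 (fun z => w z ^+ 2).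
  by move=> h; apply: eq_tame (tameM h (tame_bounded h)) _ => z; rewrite expr2.
pose W t := periodize a b N (fun z => u z * shifted_window t z).
have tW t : tame2 (W t) by exact: periodize_tame a0 b0 _ _ (tw t).
have sW t : supported2 a b (W t) by exact: periodize_supported.
have wN t z : u z * shifted_window t z != 0 -> (`|z.1| <= N%:R / a) && (`|z.2| <= N%:R / b).
  by rewrite mulf_eq0 negb_or => /andP[/uN].
have u2N z : u z ^+ 2 != 0 -> (`|z.1| <= N%:R / a) && (`|z.2| <= N%:R / b).
  by rewrite sqrf_eq0 => /uN.
have pW t k l : power2 a b (fun z => u z * shifted_window t z) k l = power2 a b (W t) k l.
  by apply: power2_periodize => //; exact: wN.
pose S := periodize a b N (fun z => u z ^+ 2).
have tS : tame2 S by exact: periodize_tame a0 b0 _ _ (tsq _ tu).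
have nS : norm2 u = int2 S by apply: int2_periodize1 => //; exact: tsq.
have sum_int F : int2 (fun z => \sum_(t <- F) W t z ^+ 2) = \sum_(t <- F) int2 (fun z => W t z ^+ 2).
  by rewrite int2_sum// => t; exact: tsq.
have tsum F : tame2 (fun z => \sum_(t <- F) W t z ^+ 2) by apply: tame_sum => t; exact: tsq.
have range z : cell2 a b z = 0 \/
    [/\ cell2 a b z = 1, 0 <= z.1 < a^-1 & 0 <= z.2 < b^-1].
  rewrite /cell2; case: (cell_range a z.1) => [->|[-> h1]]; first by left; rewrite mul0r.
  by case: (cell_range b z.2) => [->|[-> h2]]; [left; rewrite mulr0|right; rewrite mulr1].
have SE z : S z = (\sum_(j <- zbox N) u (shiftz a b j z) ^+ 2) * cell2 a b z by [].
split=> [F M uF|e e0].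
  apply: le_trans (_ : _ <= \sum_(t <- F) 4 * a^-1 * b^-1 * int2 (fun z => W t z ^+ 2)) _.
    apply: ler_sum => t _; under eq_bigr do under eq_bigr do rewrite pW.
    exact: bessel2.
  rewrite -mulr_sumr -sum_int nS -[leRHS]mulrA ler_pM2l ?mulr_gt0//.
  rewrite -int2Z//; apply: int2_le => //; first exact: tameZ.
  move=> z; rewrite SE; under eq_bigr do rewrite /W periodize_square.
  case: (range z) => [->|[-> _ _]].
    by rewrite !mulr0 big1// => t _; rewrite mulr0 expr0n.
  under eq_bigr do rewrite mulr1.
  rewrite mulr1; apply: (hB (zbox N) F (fun j => u (shiftz a b j z))) => //.
  exact: zbox_uniq.
have [F uF hF] := hA (zbox N) ((`|p%:~R| + `|q%:~R|) / sigma) (zbox_uniq N).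
have step : A * norm2 u <= \sum_(t <- F) int2 (fun z => W t z ^+ 2).
  rewrite -sum_int nS -int2Z//; apply: int2_le => //; first exact: tameZ.
  move=> z; rewrite SE; under [leRHS]eq_bigr do rewrite /W periodize_square.
  case: (range z) => [->|[-> z1 z2]].
    by rewrite !mulr0 sumr_ge0// => t _; exact: sqr_ge0.
  under [leRHS]eq_bigr do rewrite mulr1.
  have [r1 r2] := rot_bounded z1 z2.
  by rewrite mulr1; apply: (hF (fun j => u (shiftz a b j z))).
(* The error in Parseval's inequality is shared among the [t] in [F]. *)
pose n0 : R := (size F).+1%:R.
have n00 : 0 < n0 by rewrite ltr0n.
have en0 : 0 < e / n0 by rewrite divr_gt0.
have [f fP] : exists f : int * int -> nat, forall t,
    a^-1 * b^-1 * int2 (fun z => W t z ^+ 2) - e / n0 <=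
    \sum_(l <- zrange (f t)) \sum_(k <- zrange (f t)) power2 a b (W t) k l.
  exists (fun t => projT1 (cid (parseval2_lower a0 b0 (tW t) (sW t) en0))) => t.
  by case: (cid _).
pose M := (\sum_(t <- F) f t)%N.
exists F, M; split=> //.
apply: le_trans (_ : _ <= \sum_(t <- F) (a^-1 * b^-1 * int2 (fun z => W t z ^+ 2) - e / n0)) _.
  have h1 : a^-1 * b^-1 * A * norm2 u <=
      a^-1 * b^-1 * \sum_(t <- F) int2 (fun z => W t z ^+ 2).
    by rewrite -[leLHS]mulrA ler_pM2l ?mulr_gt0.
  have h2 : \sum_(t <- F) e / n0 <= e.
    rewrite big_const_seq count_predT iter_addr_0 -[leLHS]mulr_natr mulrAC ler_pdivrMr//.
    by rewrite ler_pM2l// /n0 ler_nat.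
  by rewrite sumrB -mulr_sumr lerB.
rewrite big_seq [leRHS]big_seq; apply: ler_sum => t tF.
under eq_bigr do under eq_bigr do rewrite pW.
apply: le_trans (fP t) _.
have fM : {subset zrange (f t) <= zrange M}.
  by apply: zrange_sub; rewrite /M (big_rem _ tF)/= leq_addr.
apply: le_trans (_ : \sum_(l <- zrange (f t)) \sum_(k <- zrange M) power2 a b (W t) k l <= _).
  apply: ler_sum => l _; apply: ler_sum_sub (zrange_uniq _) (zrange_uniq _) fM _ => k.
  exact: power2_ge0.
apply: ler_sum_sub (zrange_uniq _) (zrange_uniq _) fM _ => l.
by apply: sumr_ge0 => k _; exact: power2_ge0.
Qed.

End gaussian_lattice.

(** * The frame inequalities for square integrable functions *)

Lemma cvg_seq_sum (R : realType) (I : Type) (s : seq I) (f : I -> nat -> R) (l : I -> R) :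
  (forall i, f i @ \oo --> l i) ->
  (fun n => \sum_(i <- s) f i n) @ \oo --> \sum_(i <- s) l i.
Proof.
by move=> fl; apply: cvg_big => //; exact: add_continuous.
Qed.

Section square_integrable.
Context (R : realType).
Implicit Types u : R * R -> R.

Definition sq_integrable u := measurable_fun setT u /\
  (lebesgue2 R).-integrable setT (EFin \o (fun z => u z ^+ 2)).

Definition truncate (n : nat) u (z : R * R) : R :=
  if (`|u z| <= n%:R) && (gauge2 z <= n%:R) then u z else 0.

Lemma truncate_le n u z : `|truncate n u z| <= `|u z|.
Proof. by rewrite /truncate; case: ifP => //; rewrite normr0. Qed.

Lemma truncate_tame n u : measurable_fun setT u -> tame2 (truncate n u).
Proof.
move=> mu_; split; last first.
  exists n%:R => z; rewrite /truncate; case: ifP => [/andP[h1 h2]|_]; split => //.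
    by move=> h3; move: h2; rewrite leNgt h3.
  by rewrite normr0.
apply: measurable_fun_if => //.
- apply: (measurable_and (f := fun z => `|u z| <= n%:R) (g := fun z => gauge2 z <= n%:R)).
    by apply: measurable_fun_ler => //; exact: measurableT_comp.
  by apply: measurable_fun_ler => //; exact: gauge2_measurable.
- exact: measurable_funTS.
Qed.

Lemma truncate_cvg u z : (fun n => truncate n u z) @ \oo --> u z.
Proof.
pose N := (Num.truncn `|u z| + Num.truncn (gauge2 z)).+1.
apply: cvg_near_cst; near=> n.
have Nn : (N <= n)%N by near: n; exact: nbhs_infty_ge.
have h (x : R) : 0 <= x -> (Num.truncn x < n)%N -> x <= n%:R.
  move=> /truncn_itv /andP[_ /ltW /le_trans h] xn.
  by apply: h; rewrite ler_nat.
rewrite /truncate !h//.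
- by rewrite (leq_trans _ Nn)// /N ltnS ?leq_addr ?leq_addl.
- by rewrite /gauge2 le_max normr_ge0.
- by rewrite (leq_trans _ Nn)// /N ltnS ?leq_addr ?leq_addl.
Unshelve. all: by end_near. Qed.

Lemma sq_integrable_truncate_sub n u : sq_integrable u ->
  sq_integrable (fun z => u z - truncate n u z).
Proof.
move=> [mu_ iu]; have [mt _] := truncate_tame n mu_.
have md : measurable_fun setT (fun z => u z - truncate n u z) by exact: measurable_funB.
split => //; apply: le_integrable iu => //.
  by apply/measurable_EFinP; exact: measurable_funX.
move=> z _ /=; rewrite lee_fin !normrX ler_sqr ?nnegrE//.
by rewrite /truncate; case: ifP; rewrite ?subr0// subrr normr0.
Qed.

Lemma norm2_truncate_le n u : sq_integrable u -> norm2 (truncate n u) <= norm2 u.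
Proof.
move=> [mu_ iu]; have tt := truncate_tame n mu_; apply: le_Rintegral => //.
  apply: tame2_integrable; apply: eq_tame (tameM tt (tame_bounded tt)) _ => z.
  by rewrite expr2.
move=> z _; rewrite -(real_normK (num_real (truncate _ _ _))).
by rewrite -(real_normK (num_real (u z))) ler_sqr ?nnegrE// truncate_le.
Qed.

Lemma norm2_truncate_cvg u : sq_integrable u ->
  (fun n => norm2 (truncate n u)) @ \oo --> norm2 u.
Proof.
move=> [mu_ iu]; apply: (@Rintegral_dominated_cvg _ _ R (lebesgue2 R)
  (fun n z => truncate n u z ^+ 2) (fun z => u z ^+ 2) (fun z => u z ^+ 2)) => //.
- by move=> n; apply: measurable_funX; case: (truncate_tame n mu_).
- exact: measurable_funX.
- move=> n z; rewrite normrX -(real_normK (num_real (u z))) ler_sqr ?nnegrE//.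
  exact: truncate_le.
- by move=> z; under eq_fun do rewrite expr2; rewrite expr2; apply: cvgM; exact: truncate_cvg.
Qed.

Lemma norm2_truncate_sub_cvg u : sq_integrable u ->
  (fun n => norm2 (fun z => u z - truncate n u z)) @ \oo --> (0 : R).
Proof.
move=> su; have [mu_ iu] := su.
have -> : 0 = int2 (fun=> 0) :> R by rewrite /int2 Rintegral_cst// mul0r.
apply: (@Rintegral_dominated_cvg _ _ R (lebesgue2 R)
  (fun n z => (u z - truncate n u z) ^+ 2) (fun=> 0) (fun z => u z ^+ 2)) => //.
- by move=> n; apply: measurable_funX; case: (sq_integrable_truncate_sub n su).
- move=> n z; rewrite normrX -(real_normK (num_real (u z))) ler_sqr ?nnegrE//.
  by rewrite /truncate; case: ifP; rewrite ?subr0// subrr normr0.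
- move=> z; have -> : 0 = (u z - u z) * (u z - u z) :> R by rewrite subrr mulr0.
  under eq_fun do rewrite expr2.
  by apply: cvgM; apply: cvgB; [exact: cvg_cst|exact: truncate_cvg|exact: cvg_cst|exact: truncate_cvg].
Qed.

End square_integrable.

Lemma gaussian_integrable (R : realType) (al m : R) : 0 < al ->
  (@lebesgue_measure R).-integrable setT (EFin \o (fun x => expR (- (al * (x - m) ^+ 2)))).
Proof.
move=> al0; pose s := Num.sqrt (2 * al)^-1.
have s2 : s ^+ 2 = (2 * al)^-1 by rewrite sqr_sqrtr// invr_ge0 mulr_ge0// ltW.
have s0 : s != 0 by rewrite gt_eqF// sqrtr_gt0 invr_gt0 mulr_gt0.
have pk0 := normal_peak_gt0 s0.
have := integrableZl measurableT (normal_peak s)^-1 (integrable_normal_pdf m s).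
apply: eq_integrable => // x _ /=; rewrite -EFinM normal_pdfE//.
rewrite mulrA mulVf ?gt_eqF// mul1r /normal_fun s2; congr (expR _)%:E.
by rewrite -mulr_natr; field; rewrite gt_eqF.
Qed.

Lemma tensor_integrable (R : realType) (f g : R -> R) :
  measurable_fun setT f -> measurable_fun setT g ->
  (forall x, 0 <= f x) -> (forall x, 0 <= g x) ->
  (@lebesgue_measure R).-integrable setT (EFin \o f) ->
  (@lebesgue_measure R).-integrable setT (EFin \o g) ->
  (lebesgue2 R).-integrable setT (EFin \o (fun z => f z.1 * g z.2)).
Proof.
move=> mf mg f0 g0 jf jg.
have mfg : measurable_fun setT (EFin \o (fun z : R * R => f z.1 * g z.2)).
  apply/measurable_EFinP; apply: measurable_funM.
    by apply: (measurableT_comp mf); exact: measurable_fst.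
  by apply: (measurableT_comp mg); exact: measurable_snd.
apply: (@integrable12ltyP _ _ _ _ R lebesgue_measure lebesgue_measure _ mfg).2.
have Eg : (\int[lebesgue_measure]_y (g y)%:E = (int1 g)%:E)%E.
  by rewrite /int1 /Rintegral fineK//; exact: integrable_fin_num jg.
under eq_integral => x _.
  rewrite (_ : (\int[_]_y _)%E = `|(f x * int1 g)%:E|%E); last first.
    have i0 : 0 <= int1 g by apply: tame_int_ge0.
    rewrite abse_EFin ger0_norm ?mulr_ge0// EFinM -Eg -ge0_integralZl//.
    - by apply: eq_integral => y _ /=; rewrite ger0_norm// mulr_ge0.
    - exact/measurable_EFinP.
    - by move=> y _; rewrite lee_fin.
    - by rewrite lee_fin.
  over.
by have /integrableP[_] := integrableZr measurableT (int1 g) jf.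
Qed.

Section frame_real.
Context (R : realType).
Variables (p q : int) (a b c d alpha : R).
Hypotheses (pq : coprimez p q) (a0 : 0 < a) (b0 : 0 < b) (c0 : 0 < c) (d0 : 0 < d).
Hypothesis alpha0 : 0 < alpha.
Let sigma : R := Num.sqrt (p%:~R ^+ 2 + q%:~R ^+ 2).
Hypothesis cd : (c < 1 /\ d < 1) \/ (c < sigma ^+ 2 /\ d < sigma ^- 2).
Implicit Types u v : R * R -> R.

Local Notation sw := (shifted_window p q a b c d alpha).
Local Notation en := (energy p q a b c d alpha).

Let beta0 : 0 < alpha * (b ^+ 2 / a ^+ 2).
Proof. by rewrite mulr_gt0// divr_gt0// exprn_gt0. Qed.

Lemma shifted_window_range t z : 0 <= sw t z <= 1.
Proof.
rewrite /shifted_window /window expR_ge0/= -expR0 ler_expR oppr_le0.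
by apply: addr_ge0; apply: mulr_ge0 (sqr_ge0 _); exact: ltW.
Qed.

Lemma shifted_window_integrable t : (lebesgue2 R).-integrable setT (EFin \o sw t).
Proof.
pose f x := expR (- (alpha * (x - (node p q a b c d t).1) ^+ 2)).
pose g x := expR (- (alpha * (b ^+ 2 / a ^+ 2) * (x - (node p q a b c d t).2) ^+ 2)).
have jf := gaussian_integrable (node p q a b c d t).1 alpha0.
have jg := gaussian_integrable (node p q a b c d t).2 beta0.
have mf : measurable_fun setT f by apply/measurable_EFinP; case/integrableP: jf.
have mg : measurable_fun setT g by apply/measurable_EFinP; case/integrableP: jg.
have := tensor_integrable mf mg (fun _ => expR_ge0 _) (fun _ => expR_ge0 _) jf jg.
apply: eq_integrable => // z _ /=; congr EFin.
by rewrite /f /g -expRD /shifted_window /window -opprD.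
Qed.

(** An integrable bound for [u * sw t], since [x * y <= x ^+ 2 + y] when
    [0 <= y <= 1]. *)
Let dom u t z := u z ^+ 2 + sw t z.

Let dom_integrable u t : sq_integrable u ->
  (lebesgue2 R).-integrable setT (EFin \o dom u t).
Proof.
move=> [_ iu]; have := integrableD measurableT iu (shifted_window_integrable t).
by apply: eq_integrable.
Qed.

Let wv e1 e2 k l (z : R * R) := wave e1 (a * k%:~R) z.1 * wave e2 (b * l%:~R) z.2.

Let wv_le e1 e2 k l z : `|wv e1 e2 k l z| <= 1.
Proof.
have h e om (x : R) : `|wave e om x| <= 1.
  by rewrite /wave ler_norml; case: e; rewrite ?sin_geN1 ?sin_le1 ?cos_geN1 ?cos_le1.
by rewrite /wv normrM mulr_ile1.
Qed.

Let wv_bounded e1 e2 k l : bounded_meas (wv e1 e2 k l).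
Proof.
by apply: bounded_measM; [apply: bounded_meas_fst|apply: bounded_meas_snd];
  exact: wave_bounded.
Qed.

Let prod_le u v t e1 e2 k l z : `|v z| <= `|u z| ->
  `|v z * sw t z * wv e1 e2 k l z| <= dom u t z.
Proof.
move=> vu; have /andP[s0 s1] := shifted_window_range t z.
rewrite normrM (normrM (v z)) (ger0_norm s0).
apply: le_trans (_ : `|v z| * sw t z <= _).
  by rewrite -[leRHS]mulr1; apply: ler_wpM2l; [exact: mulr_ge0|exact: wv_le].
rewrite /dom -(real_normK (num_real (u z))); set x := `|u z| in vu *.
have x0 : 0 <= x := normr_ge0 _.
apply: le_trans (ler_wpM2r s0 vu) _.
by have : 0 <= (x - sw t z) ^+ 2 := sqr_ge0 _; nra.
Qed.

Let prod_measurable v t e1 e2 k l : measurable_fun setT v ->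
  measurable_fun setT (fun z => v z * sw t z * wv e1 e2 k l z).
Proof.
move=> mv; apply: measurable_funM; last by case: (wv_bounded e1 e2 k l).
by apply: measurable_funM => //; case: (@shifted_window_bounded _ p q a b c d alpha _ _ _ t).
Qed.

Lemma prod_integrable u t e1 e2 k l : sq_integrable u ->
  (lebesgue2 R).-integrable setT (EFin \o (fun z => u z * sw t z * wv e1 e2 k l z)).
Proof.
move=> su; apply: le_integrable (dom_integrable t su) => //.
  by apply/measurable_EFinP; apply: prod_measurable; case: su.
move=> z _ /=; rewrite lee_fin; apply: le_trans (prod_le _ _ _ _ _ (lexx _)) _.
exact: ler_norm.
Qed.

Lemma energy_truncate_cvg F M u : sq_integrable u ->
  (fun n => en F M (truncate n u)) @ \oo --> en F M u.
Proof.
move=> su; have [mu_ _] := su.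
do 3 (apply: cvg_seq_sum => ?); rewrite /power2; do 2 (apply: cvg_seq_sum => ?).
under eq_fun do rewrite expr2; rewrite expr2.
have h t e1 e2 k l : (fun n => coef2 a b e1 e2 k l (fun z => truncate n u z * sw t z)) @ \oo -->
    coef2 a b e1 e2 k l (fun z => u z * sw t z).
  apply: (@Rintegral_dominated_cvg _ _ R (lebesgue2 R)
    (fun n z => truncate n u z * sw t z * wv e1 e2 k l z)
    (fun z => u z * sw t z * wv e1 e2 k l z) (dom u t)).
  - by move=> n; apply: prod_measurable; case: (truncate_tame n mu_).
  - exact: prod_measurable.
  - exact: dom_integrable.
  - by move=> n z; apply: prod_le; exact: truncate_le.
  - move=> z; apply: cvgM; last exact: cvg_cst.
    by apply: cvgM; [exact: truncate_cvg|exact: cvg_cst].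
by apply: cvgM; exact: h.
Qed.

Lemma energy_sub_le F M u v : sq_integrable u -> sq_integrable (fun z => u z - v z) ->
  en F M v <= 2 * en F M u + 2 * en F M (fun z => u z - v z).
Proof.
move=> su sd; rewrite /energy !mulr_sumr -big_split/=; apply: ler_sum => t _.
rewrite !mulr_sumr -big_split/=; apply: ler_sum => l _.
rewrite !mulr_sumr -big_split/=; apply: ler_sum => k _.
rewrite /power2 !mulr_sumr -big_split/=; apply: ler_sum => e1 _.
rewrite !mulr_sumr -big_split/=; apply: ler_sum => e2 _.
have -> : coef2 a b e1 e2 k l (fun z => v z * sw t z) =
   coef2 a b e1 e2 k l (fun z => u z * sw t z) -
   coef2 a b e1 e2 k l (fun z => (u z - v z) * sw t z).
  have j1 := prod_integrable t e1 e2 k l su; have j2 := prod_integrable t e1 e2 k l sd.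
  rewrite /coef2 /int2 -(RintegralB measurableT j1 j2); congr Rintegral.
  by apply/funext => z; rewrite /wv; ring.
set x := coef2 _ _ _ _ _ _ _; set y := coef2 _ _ _ _ _ _ _.
by have := sqr_ge0 (x + y); nra.
Qed.

(** The upper bound passes to the limit of the truncations.  For the lower bound
    [u] is compared with a truncation that is close in norm, at the price of a
    factor 2 in [energy_sub_le]. *)
Theorem real_frame : exists A B : R, [/\ 0 < A, 0 < B &
  forall u, sq_integrable u ->
    (forall F M, uniq F -> en F M u <= B * norm2 u) /\
    (forall e, 0 < e -> exists F M, uniq F /\ A * norm2 u - e <= en F M u)].
Proof.
have [A [B [A0 B0 H]]] := tame_frame pq a0 b0 c0 d0 alpha0 cd.
have upper u F M : sq_integrable u -> uniq F -> en F M u <= B * norm2 u.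
  move=> su uF; refine (cvgr_to_le (energy_truncate_cvg (F := F) (M := M) su) _).
  apply: nearW => n; have [mu_ _] := su.
  have [h _] := H _ (truncate_tame n mu_).
  by apply: le_trans (h F M uF) _; rewrite ler_pM2l// norm2_truncate_le.
exists (A / 2), B; split; [by rewrite divr_gt0|by []|] => u su.
split=> [F M uF|e e0]; first exact: upper.
have [mu_ _] := su.
have e1 : 0 < e / (2 * A) by rewrite divr_gt0// mulr_gt0.
have e2 : 0 < e / (4 * B) by rewrite divr_gt0// mulr_gt0.
have /cvgrPdist_lt /(_ _ e1) h1 := norm2_truncate_cvg su.
have /cvgrPdist_lt /(_ _ e2) h2 := norm2_truncate_sub_cvg su.
have [n [n1 n2]] : exists n, `|norm2 u - norm2 (truncate n u)| < e / (2 * A) /\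
    `|0 - norm2 (fun z => u z - truncate n u z)| < e / (4 * B).
  near \oo => n; exists n; split; near: n; [exact: h1|exact: h2].
have e30 : 0 < e / 2 by rewrite divr_gt0.
have [_ /(_ _ e30) [F [M [uF hF]]]] := H _ (truncate_tame n mu_).
exists F, M; split=> //.
have sd := sq_integrable_truncate_sub n su.
have := energy_sub_le F M su sd; have := upper _ F M sd uF.
move: n1 n2; rewrite sub0r normrN => /(le_lt_trans (ler_norm _)) n1.
move=> /(le_lt_trans (ler_norm _)) n2.
have {}n1 : A * (norm2 u - norm2 (truncate n u)) < e / 2.
  have -> : e / 2 = A * (e / (2 * A)) by field; rewrite gt_eqF.
  by rewrite ltr_pM2l.
have {}n2 : B * norm2 (fun z => u z - truncate n u z) < e / 4.
  have -> : e / 4 = B * (e / (4 * B)) by field; rewrite gt_eqF.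
  by rewrite ltr_pM2l.
lra.
Unshelve. all: by end_near. Qed.

End frame_real.

(** * Complex-valued functions and the lattice sum *)

Section complex_frame.
Context (R : realType).
Variables (p q : int) (a b c d alpha : R).
Hypotheses (pq : coprimez p q) (a0 : 0 < a) (b0 : 0 < b) (c0 : 0 < c) (d0 : 0 < d).
Hypothesis alpha0 : 0 < alpha.
Local Notation sw := (shifted_window p q a b c d alpha).
Local Notation beta := (alpha * (b ^+ 2 / a ^+ 2)).

Lemma L2norm_sqr (f : R * R -> R[i]) : inL2 f ->
  [/\ sq_integrable (fun z => complex.Re (f z)),
      sq_integrable (fun z => complex.Im (f z)) &
      (L2norm f ^+ 2)%E =
      (norm2 (fun z => complex.Re (f z)) + norm2 (fun z => complex.Im (f z)))%:E].
Proof.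
move=> [[mr mi] fL].
pose r z := complex.Re (f z); pose i z := complex.Im (f z).
have [l l0 lE] : exists2 l : R, 0 <= l & L2norm f = l%:E.
  have f0 : (0 <= L2norm f)%E by exact: Lnorm_ge0.
  exists (fine (L2norm f)); first exact: fine_ge0.
  by rewrite fineK// ge0_fin_numE.
have E : (L2norm f ^+ 2)%E = (\int[lebesgue2 R]_z (r z ^+ 2 + i z ^+ 2)%:E)%E.
  rewrite lE -EFin_expe -powR_mulrn// -poweR_EFin -lE /L2norm poweR_Lnorm ?pnatr_eq0//.
  apply: eq_integral => z _; rewrite abse_EFin poweR_EFin powR_mulrn//.
  rewrite /r /i; case: (f z) => x y /=; rewrite ger0_norm ?sqrtr_ge0//.
  by rewrite sqr_sqrtr// addr_ge0 ?sqr_ge0.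
have fin : ((L2norm f ^+ 2)%E < +oo)%E.
  by rewrite lE -EFin_expe ltry.
have mr2 : measurable_fun setT (fun z => r z ^+ 2) by exact: measurable_funX.
have mi2 : measurable_fun setT (fun z => i z ^+ 2) by exact: measurable_funX.
have isum : (lebesgue2 R).-integrable setT (EFin \o (fun z => r z ^+ 2 + i z ^+ 2)).
  apply/integrableP; split; first by apply/measurable_EFinP; exact: measurable_funD.
  rewrite E in fin; apply: le_lt_trans fin.
  rewrite le_eqVlt; apply/orP; left; apply/eqP; apply: eq_integral => z _ /=.
  by rewrite ger0_norm// addr_ge0 ?sqr_ge0.
have ir : (lebesgue2 R).-integrable setT (EFin \o (fun z => r z ^+ 2)).
  apply: le_integrable isum => //; first exact/measurable_EFinP.
  by move=> z _ /=; rewrite lee_fin !ger0_norm ?addr_ge0 ?sqr_ge0// lerDl sqr_ge0.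
have ii : (lebesgue2 R).-integrable setT (EFin \o (fun z => i z ^+ 2)).
  apply: le_integrable isum => //; first exact/measurable_EFinP.
  by move=> z _ /=; rewrite lee_fin !ger0_norm ?addr_ge0 ?sqr_ge0// lerDr sqr_ge0.
split => //.
rewrite E -[norm2 _ + norm2 _]/(norm2 r + norm2 i) /norm2 /int2.
rewrite -RintegralD// /Rintegral fineK//; exact: integrable_fin_num isum.
Qed.

Definition tf_point (x : (int * int) * (int * int)) : (R * R) * (R * R) :=
  (node p q a b c d x.1, (a * x.2.1%:~R, b * x.2.2%:~R)).

Lemma tf_latticeE : tf_lattice p q a b c d = range tf_point.
Proof.
apply/seteqP; split.
  move=> [[t1 t2] [w1 w2]] [/= [[s1 s2] [/= [m _ <-] [n _ <-]] [<- <-]] [[k _ <-] [l _ <-]]].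
  exists ((m, n), (k, l)) => //; rewrite /tf_point /node /=; congr (_, _, _).
    by rewrite !mxE /= !big_ord_recl big_ord0 !mxE /= addr0 mulNr mulNr.
  by rewrite !mxE /= !big_ord_recl big_ord0 !mxE /= addr0.
move=> _ [[[m n] [k l]] _ <-]; split=> /=; last by split; [exists k|exists l].
exists (c / Num.sqrt (p%:~R ^+ 2 + q%:~R ^+ 2) * m%:~R,
        d * Num.sqrt (p%:~R ^+ 2 + q%:~R ^+ 2) * n%:~R).
  by split=> /=; [exists m|exists n].
rewrite /node /=; congr pair.
  by rewrite !mxE /= !big_ord_recl big_ord0 !mxE /= addr0 mulNr mulNr.
by rewrite !mxE /= !big_ord_recl big_ord0 !mxE /= addr0.
Qed.

Lemma tf_point_inj : injective tf_point.
Proof.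
move=> [[m n] [k l]] [[m' n'] [k' l']] [] h1 h2 /mulfI h3 /mulfI h4.
have {}h3 : k = k' by apply/eqP; rewrite -(eqr_int R); apply/eqP/h3; rewrite gt_eqF.
have {}h4 : l = l' by apply/eqP; rewrite -(eqr_int R); apply/eqP/h4; rewrite gt_eqF.
have s0 := sigma_gt0 R pq; have sE := sigma_sqr R pq; have n0 := norm_pq_gt0 R pq.
move: h1 h2; rewrite /node /=.
set s := Num.sqrt _ in s0 sE *; move: (p%:~R : R) (q%:~R : R) sE n0 => P Q sE n0 h1 h2.
pose u := c / s * (m%:~R - m'%:~R) : R; pose v := d * s * (n%:~R - n'%:~R) : R.
have e1 : P * u - Q * v = 0.
  have := congr1 (fun z => a * s * z) h1; move/eqP; rewrite -subr_eq0 => /eqP <-.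
  by rewrite /u /v; field; rewrite !gt_eqF.
have e2 : Q * u + P * v = 0.
  have := congr1 (fun z => b * s * z) h2; move/eqP; rewrite -subr_eq0 => /eqP <-.
  by rewrite /u /v; field; rewrite !gt_eqF.
have u0 : (P ^+ 2 + Q ^+ 2) * u = 0.
  have -> : (P ^+ 2 + Q ^+ 2) * u = P * (P * u - Q * v) + Q * (Q * u + P * v) by ring.
  by rewrite e1 e2 !mulr0 addr0.
have v0 : (P ^+ 2 + Q ^+ 2) * v = 0.
  have -> : (P ^+ 2 + Q ^+ 2) * v = P * (Q * u + P * v) - Q * (P * u - Q * v) by ring.
  by rewrite e1 e2 !mulr0 subr0.
have [cs ds] : c / s != 0 /\ d * s != 0.
  by rewrite !mulf_neq0 ?invr_eq0 ?gt_eqF.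
move/eqP: u0; rewrite mulf_eq0 (gt_eqF n0)/= mulf_eq0 (negPf cs)/= subr_eq0 eqr_int => /eqP ->.
move/eqP: v0; rewrite mulf_eq0 (gt_eqF n0)/= mulf_eq0 (negPf ds)/= subr_eq0 eqr_int => /eqP ->.
by rewrite h3 h4.
Qed.

Let J (v : R * R -> R) t e1 e2 k l := coef2 a b e1 e2 k l (fun z => v z * sw t z).

(** The bilinear expansion of the coefficient of a complex [f] into the real
    trigonometric coefficients of its real and imaginary parts. *)
Lemma inner_tf_point (f : R * R -> R[i]) t k l :
  sq_integrable (fun z => complex.Re (f z)) -> sq_integrable (fun z => complex.Im (f z)) ->
  let A e1 e2 := J (fun z => complex.Re (f z)) t e1 e2 k l in
  let B e1 e2 := J (fun z => complex.Im (f z)) t e1 e2 k l in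
  Normc.normc (inner (tfshift (tf_point (t, (k, l))) (gaussian alpha beta)) f) ^+ 2 =
  ((A false false - A true true) + (B true false + B false true)) ^+ 2 +
  ((A true false + A false true) - (B false false - B true true)) ^+ 2.
Proof.
move=> sr si A B.
pose r z := complex.Re (f z); pose i z := complex.Im (f z).
pose h v e1 e2 (z : R * R) := v z * sw t z * (wave e1 (a * k%:~R) z.1 * wave e2 (b * l%:~R) z.2).
have jr e1 e2 : (lebesgue2 R).-integrable setT (EFin \o h r e1 e2).
  exact: (prod_integrable _ _ _ _ a0 b0 alpha0 t e1 e2 k l sr).
have ji e1 e2 : (lebesgue2 R).-integrable setT (EFin \o h i e1 e2).
  exact: (prod_integrable _ _ _ _ a0 b0 alpha0 t e1 e2 k l si).
have linE (f1 f2 : R * R -> R) :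
  (lebesgue2 R).-integrable setT (EFin \o f1) -> (lebesgue2 R).-integrable setT (EFin \o f2) ->
  (lebesgue2 R).-integrable setT (EFin \o (fun z => f1 z + f2 z)) /\
  (lebesgue2 R).-integrable setT (EFin \o (fun z => f1 z - f2 z)).
  by move=> j1 j2; split; [have := integrableD measurableT j1 j2|
    have := integrableB measurableT j1 j2]; apply: eq_integrable.
have Re_E : int2 (fun z => complex.Re (tfshift (tf_point (t, (k, l))) (gaussian alpha beta) z * conjc (f z))) =
    (A false false - A true true) + (B true false + B false true).
  have [_ j1] := linE _ _ (jr false false) (jr true true).
  have [j2 _] := linE _ _ (ji true false) (ji false true).
  rewrite -[A false false - _](RintegralB measurableT (jr _ _) (jr _ _)).
  rewrite -[B true false + _](RintegralD measurableT (ji _ _) (ji _ _)).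
  rewrite -[RHS](RintegralD measurableT j1 j2); congr int2; apply/funext => z.
  rewrite /h /tfshift /gaussian /expi /shifted_window /window /wave /r /i /=.
  rewrite (mulrAC (2 * pi) z.1) (mulrAC (2 * pi) z.2); case: (f z) => x y /=.
  ring.
have Im_E : int2 (fun z => complex.Im (tfshift (tf_point (t, (k, l))) (gaussian alpha beta) z * conjc (f z))) =
    (A true false + A false true) - (B false false - B true true).
  have [j1 _] := linE _ _ (jr true false) (jr false true).
  have [_ j2] := linE _ _ (ji false false) (ji true true).
  rewrite -[A true false + _](RintegralD measurableT (jr _ _) (jr _ _)).
  rewrite -[B false false - _](RintegralB measurableT (ji _ _) (ji _ _)).
  rewrite -[RHS](RintegralB measurableT j1 j2); congr int2; apply/funext => z.
  rewrite /h /tfshift /gaussian /expi /shifted_window /window /wave /r /i /=.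
  rewrite (mulrAC (2 * pi) z.1) (mulrAC (2 * pi) z.2); case: (f z) => x y /=.
  ring.
rewrite /inner /cintegral /= -/(int2 _) -/(int2 _).
rewrite sqr_sqrtr ?addr_ge0 ?sqr_ge0//.
by rewrite -Re_E -Im_E.
Qed.

Lemma wave_flip e (s x : R) : wave e (- s) x = (if e then -1 else 1) * wave e s x.
Proof.
rewrite /wave !(mulrN, mulNr); case: e; first by rewrite sinN mulN1r.
by rewrite cosN mul1r.
Qed.

Let J_flip v t e1 e2 k l (s1 s2 : bool) : sq_integrable v ->
  J v t e1 e2 (if s1 then - k else k) (if s2 then - l else l) =
  (if e1 && s1 then -1 else 1) * (if e2 && s2 then -1 else 1) * J v t e1 e2 k l.
Proof.
move=> sv; have j := prod_integrable p q c d a0 b0 alpha0 t e1 e2 k l sv.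
rewrite [X in _ = _ * X]/J /coef2 /int2 -(RintegralZl _ measurableT j).
congr Rintegral; apply/funext => z.
have flip (e s : bool) (om : R) (m : int) (x : R) :
    wave e (om * (if s then - m else m)%:~R) x = (if e && s then -1 else 1) * wave e (om * m%:~R) x.
  case: s; last by rewrite andbF mul1r.
  rewrite andbT (_ : om * (- m)%:~R = - (om * m%:~R)); last by rewrite mulrNz mulrN.
  exact: wave_flip.
by rewrite !flip; ring.
Qed.

(** A sign change of [k] or [l] changes the sign of the coefficients that contain
    a sine in the corresponding variable.  Averaging over the four sign changes
    removes every mixed product from [inner_tf_point], and the squares of the
    eight real coefficients remain. *)
Lemma box_energy (f : R * R -> R[i]) F M :
  sq_integrable (fun z => complex.Re (f z)) -> sq_integrable (fun z => complex.Im (f z)) ->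
  \sum_(t <- F) \sum_(l <- zrange M) \sum_(k <- zrange M)
    Normc.normc (inner (tfshift (tf_point (t, (k, l))) (gaussian alpha beta)) f) ^+ 2 =
  energy p q a b c d alpha F M (fun z => complex.Re (f z)) +
  energy p q a b c d alpha F M (fun z => complex.Im (f z)).
Proof.
move=> sr si; rewrite /energy -big_split/=; apply: eq_bigr => t _.
pose h k l := Normc.normc (inner (tfshift (tf_point (t, (k, l))) (gaussian alpha beta)) f) ^+ 2.
rewrite (sum_zrange_signs M h) -big_split/=; apply: eq_bigr => l _; rewrite -big_split/=; apply: eq_bigr => k _.
rewrite /h (inner_tf_point t k l sr si) (inner_tf_point t (- k) l sr si).
rewrite (inner_tf_point t k (- l) sr si) (inner_tf_point t (- k) (- l) sr si).
have fl v e1 e2 (s1 s2 : bool) := @J_flip v t e1 e2 k l s1 s2.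
have f10 v e1 e2 (sv : sq_integrable v) := fl v e1 e2 true false sv.
have f01 v e1 e2 (sv : sq_integrable v) := fl v e1 e2 false true sv.
have f11 v e1 e2 (sv : sq_integrable v) := fl v e1 e2 true true sv.
rewrite /= in f10 f01 f11.
rewrite !(f10 _ _ _ sr) !(f10 _ _ _ si) !(f01 _ _ _ sr) !(f01 _ _ _ si).
rewrite !(f11 _ _ _ sr) !(f11 _ _ _ si) /=.
rewrite /power2 !big_cons !big_nil -!/(J _ _ _ _ _ _).
by field.
Qed.

End complex_frame.

(** * The frame inequalities for the Gabor system *)

Section esum_finite.
Context (R : realType) (T : choiceType) (h : T -> R).

Lemma esum_le_sup (C : R) :
  (forall s : seq T, uniq s -> \sum_(x <- s) h x <= C) ->
  (\esum_(x in setT) (h x)%:E <= C%:E)%E.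
Proof.
move=> hC; apply: ge_ereal_sup => _ [X [finX _] <-].
rewrite fsbig_finite//= sumEFin lee_fin; apply: hC; exact: finmap.fset_uniq.
Qed.

Lemma sum_le_esum (s : seq T) : uniq s ->
  ((\sum_(x <- s) h x)%:E <= \esum_(x in setT) (h x)%:E)%E.
Proof.
move=> us; apply: esum_ge; exists [set` s] => //.
by rewrite -fsbig_seq// sumEFin.
Qed.

End esum_finite.

Theorem corollary1p6 (R : realType) (p q : int) (a b c d alpha : R) :
  coprimez p q ->
  0 < a -> 0 < b -> 0 < c -> 0 < d -> 0 < alpha ->
  let sigma := Num.sqrt (p%:~R ^+ 2 + q%:~R ^+ 2) in
  let beta := alpha * (b ^+ 2 / a ^+ 2) in
  (c < 1 /\ d < 1) \/ (c < sigma ^+ 2 /\ d < sigma ^- 2) ->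
  gabor_frame (gaussian alpha beta) (tf_lattice p q a b c d).
Proof.
move=> pq a0 b0 c0 d0 alpha0 sigma beta cd.
have [A [B [A0 B0 H]]] := real_frame pq a0 b0 c0 d0 alpha0 cd.
exists (A / 2), B; split=> [||f /L2norm_sqr[sr si ->]]; [exact: divr_gt0|by []|].
pose h x := Normc.normc (inner (tfshift (tf_point p q a b c d x) (gaussian alpha beta)) f) ^+ 2.
have h0 x : 0 <= h x by exact: sqr_ge0.
have -> : gabor_energy (gaussian alpha beta) (tf_lattice p q a b c d) f =
    (\esum_(x in setT) (h x)%:E)%E.
  rewrite /gabor_energy tf_latticeE// esum_image//.
  by apply: in2W; exact: tf_point_inj.
pose box (F : seq (int * int)) M := [seq (t, y) | t <- F, y <- zbox M].
have boxu F M : uniq F -> uniq (box F M).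
  by move=> uF; rewrite allpairs_pair_uniq// zbox_uniq.
pose en := energy p q a b c d alpha.
pose r z := complex.Re (f z); pose i z := complex.Im (f z).
have boxE F M : \sum_(x <- box F M) h x = en F M r + en F M i.
  rewrite -box_energy// big_allpairs; apply: eq_bigr => t _.
  by rewrite big_allpairs; exact: exchange_big.
have [ur lr] := H _ sr; have [ui li] := H _ si.
have en0 F M v : 0 <= en F M v.
  by do 3 (apply: sumr_ge0 => ? _); exact: power2_ge0.
rewrite -!EFinM; apply/andP; split.
  apply/lee_subgt0Pr => e e0; rewrite -EFinB.
  have [F [M [uF hF]]] := lr _ e0; have [G [N [uG hG]]] := li _ e0.
  have le1 := sum_le_esum h (boxu _ M uF); have le2 := sum_le_esum h (boxu _ N uG).
  (* The lower bounds for [r] and [i] hold on different finite sets; using only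
     the larger of the two norms costs a factor 2. *)
  rewrite -/en -/r in hF; rewrite -/en -/i in hG; have r0 := en0 G N r; have i0 := en0 F M i.
  have [ir|/ltW ri] := leP (norm2 i) (norm2 r).
    apply: le_trans le1; rewrite lee_fin boxE; have := ler_wpM2l (ltW A0) ir.
    by clear - hF i0; rewrite -/r -/i; lra.
  apply: le_trans le2; rewrite lee_fin boxE; have := ler_wpM2l (ltW A0) ri.
  by clear - hG r0; rewrite -/r -/i; lra.
apply: esum_le_sup => s us.
have [M sM] := exists_zrange2 [seq x.2 | x <- s].
have sb : {subset s <= box (undup [seq x.1 | x <- s]) M}.
  move=> [t [k l]] ts; apply/allpairs_f; first by rewrite mem_undup (map_f fst ts).
  by have /andP[] := sM _ (map_f snd ts); exact: allpairs_f.
apply: le_trans (ler_sum_sub us (boxu _ _ (undup_uniq _)) sb h0) _.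
by rewrite boxE mulrDr lerD// ?ur ?ui ?undup_uniq.
Qed.
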